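(* Let $G$ and $H$ be discrete groups, let $\mathcal{A}=(A_g)_{g\in G}$ and $\mathcal{B}=(B_h)_{h\in H}$ be unital Fell bundles, let $\varphi\in \mathrm{Hom}(G,H)$, and let $T=(T_g)_{g\in G}$ be a positive definite $\mathcal{A}$-$\varphi$-$\mathcal{B}$ bundle map. Then there exist a Hilbert $\mathcal{B}$-bundle $\mathcal{X}=(X_h)_{h\in H}$, an $(\mathcal{A},\varphi)$-action $\rho$ on $\mathcal{X}$, and $\xi\in X_e$ such that \[T_g(a)=\langle \xi,\rho(a)\xi\rangle_{\mathcal{B}}\quad\text{for all } g\in G \text{ and } a\in A_g.\]
   Context: Groups are discrete and $e$ denotes the unit of any group. A Fell bundle $\mathcal{A}=(A_g)_{g\in G}$ is in the sense of Exel: Banach spaces $A_g$ with bilinear associative multiplications $A_g\times A_h\to A_{gh}$ and conjugate-linear involutions $A_g\to A_{g^{-1}}$ satisfying $\|ab\|\le\|a\|\|b\|$, $(ab)^*=b^*a^*$, $a^{**}=a$, $\|a^*a\|=\|a\|^2$ and $a^*a\ge 0$ in the $C^*$-algebra $A_e$; the symbol $\mathcal{A}$ also denotes the disjoint union of the fibres. $\mathcal{A}$ is unital if $A_e$ is unital. An $\mathcal{A}$-$\varphi$-$\mathcal{B}$ bundle map is a family $T=(T_g)_{g\in G}$ of bounded linear maps $T_g:A_g\to B_{\varphi(g)}$. It is positive definite if $\sum_{i,j=1}^n b_i\,T_{g_i^{-1}g_j}(a_i^*a_j)\,b_j^*\ge 0$ in $B_e$ for all $n\in\mathbb{N}$,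 $g_1,\dots,g_n\in G$, $a_i\in A_{g_i}$, $b_i\in B_{\varphi(g_i)}$. A Hilbert $\mathcal{B}$-bundle is a family $\mathcal{X}=(X_r)_{r\in H}$ of complex Banach spaces (also denoting their disjoint union) with maps $\mathcal{X}\times\mathcal{B}\to\mathcal{X}$, $(x,b)\mapsto xb$, and $\mathcal{X}\times\mathcal{X}\to\mathcal{B}$, $(x,y)\mapsto\langle x,y\rangle_{\mathcal{B}}$, such that: (1) $X_rB_s\subseteq X_{rs}$ and $(x,b)\mapsto xb$ is bilinear from $X_r\times B_s$ to $X_{rs}$; (2) $\langle X_r,X_s\rangle_{\mathcal{B}}\subseteq B_{r^{-1}s}$ and $y\mapsto\langle x,y\rangle_{\mathcal{B}}$ is linear on $X_s$ for each $x\in X_r$; (3) $\langle x,yb\rangle_{\mathcal{B}}=\langle x,y\rangle_{\mathcal{B}}b$ and $\langle x,y\rangle_{\mathcal{B}}^*=\langle y,x\rangle_{\mathcal{B}}$; (4) $\langle x,x\rangle_{\mathcal{B}}\ge0$ in $B_e$, and $\langle x,x\rangle_{\mathcal{B}}=0$ implies $x=0$; (5) the norm of $X_r$ satisfies $\|x\|=\|\langle x,x\rangle_{\mathcal{B}}\|^{1/2}$. For a Hilbert $\mathcal{B}$-bundle $\mathcal{X}$, let $\mathcal{F}(\mathcal{X})$ be the semigroup of all maps $\mathcal{X}\to\mathcal{X}$. An $(\mathcal{A},\varphi)$-action on $\mathcal{X}$ is a map $\rho:\mathcal{A}\to\mathcal{F}(\mathcal{X})$ such that: (i) $\rho(A_g)X_h\subseteq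 X_{\varphi(g)h}$ and $(a,x)\mapsto\rho(a)x$ is bilinear from $A_g\times X_h$ to $X_{\varphi(g)h}$; (ii) $\rho(aa')=\rho(a)\rho(a')$; (iii) $\langle\rho(a)x,y\rangle_{\mathcal{B}}=\langle x,\rho(a^* )y\rangle_{\mathcal{B}}$; (iv) $(\rho(a)x)b=\rho(a)(xb)$, for all $a,a'\in\mathcal{A}$, $x,y\in\mathcal{X}$, $b\in\mathcal{B}$. *)

(* Defs.v *)
From HB Require Import structures.
From mathcomp Require Import all_boot all_order all_algebra.
From mathcomp Require Import complex.
From mathcomp Require Import all_classical all_reals all_analysis.
From mathcomp Require Import Rstruct Rstruct_topology.
Import Order.TTheory GRing.Theory Num.Theory.
Set Implicit Arguments. Unset Strict Implicit. Unset Printing Implicit Defensive.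
Local Open Scope ring_scope.

Definition C : numClosedFieldType := (Rdefinitions.R)[i].

Record DGroup := {
  gcar :> Type;
  gm : gcar -> gcar -> gcar;
  gone : gcar;
  ginv : gcar -> gcar;
  gmA : forall x y z, gm x (gm y z) = gm (gm x y) z;
  gm1x : forall x, gm gone x = x;
  gmx1 : forall x, gm x gone = x;
  gmVx : forall x, gm (ginv x) x = gone;
  gmxV : forall x, gm x (ginv x) = gone }.
Arguments gm {d}. Arguments gone {d}. Arguments ginv {d}.

Definition is_hom (G H : DGroup) (phi : G -> H) : Prop :=
  forall x y : G, phi (gm x y) = gm (phi x) (phi y).

(* Raw data of a bundle over G: fibres (complex Banach spaces),        *)
(* multiplication, involution, unit of A_e. Elements of different      *)
(* fibres are compared in the total space {g : G & fib g} (disjoint    *)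
(* union), which avoids transporting along group-law equalities.       *)
Section Raw.
Context (G : DGroup) (fib : G -> completeNormedModType C)
  (fmul : forall g h, fib g -> fib h -> fib (gm g h))
  (fstar : forall g, fib g -> fib (ginv g)) (u : fib gone).

Definition invertible_e (x : fib gone) : Prop :=
  exists y : fib gone,
    existT fib _ (fmul x y) = existT fib gone u /\
    existT fib _ (fmul y x) = existT fib gone u.

(* x >= 0 in the unital C*-algebra A_e: x is self-adjoint and its spectrum
   is contained in [0, oo), i.e. x - l 1 is invertible for every complex
   l outside [0, oo) (for complex l, 0 <= l means l real and nonnegative). *)
Definition positive_e (x : fib gone) : Prop :=
  existT fib _ (fstar x) = existT fib gone x /\
  forall l : C, ~ (0 <= l) -> invertible_e (x - l *: u).

Definition posT (s : {g : G & fib g}) : Prop :=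
  exists x : fib gone, s = existT fib gone x /\ positive_e x.
End Raw.

Record UFellBundle (G : DGroup) := {
  fib : G -> completeNormedModType C;
  fmul : forall g h, fib g -> fib h -> fib (gm g h);
  fstar : forall g, fib g -> fib (ginv g);
  funit : fib gone;
  fmul_linl : forall g h (k : C) (a a' : fib g) (b : fib h),
      fmul (k *: a + a') b = k *: fmul a b + fmul a' b;
  fmul_linr : forall g h (k : C) (a : fib g) (b b' : fib h),
      fmul a (k *: b + b') = k *: fmul a b + fmul a b';
  fstar_conjlin : forall g (k : C) (a a' : fib g),
      fstar (k *: a + a') = k^* *: fstar a + fstar a';
  fmul_norm : forall g h (a : fib g) (b : fib h),
      `|fmul a b| <= `|a| * `|b|;
  fmulA : forall g h k (a : fib g) (b : fib h) (c : fib k),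
      existT fib _ (fmul (fmul a b) c) = existT fib _ (fmul a (fmul b c));
  fstarM : forall g h (a : fib g) (b : fib h),
      existT fib _ (fstar (fmul a b)) = existT fib _ (fmul (fstar b) (fstar a));
  fstarK : forall g (a : fib g), existT fib _ (fstar (fstar a)) = existT fib _ a;
  fCstar : forall g (a : fib g), `|fmul (fstar a) a| = `|a| ^+ 2;
  fpos : forall g (a : fib g), posT fmul fstar funit (existT fib _ (fmul (fstar a) a));
  funit_l : forall a : fib gone, existT fib _ (fmul funit a) = existT fib gone a;
  funit_r : forall a : fib gone, existT fib _ (fmul a funit) = existT fib gone a }.
Arguments fib {G} u. Arguments fmul {G} u {g h}. Arguments fstar {G} u {g}.
Arguments funit {G}.

Definition Bpos (G : DGroup) (B : UFellBundle G) (s : {g : G & fib B g}) : Prop :=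
  posT (@fmul G B) (@fstar G B) (funit B) s.

Definition is_bundle_map (G H : DGroup) (A : UFellBundle G) (B : UFellBundle H)
    (phi : G -> H) (T : forall g : G, fib A g -> fib B (phi g)) : Prop :=
  forall g : G,
    (forall (k : C) (a a' : fib A g), T g (k *: a + a') = k *: T g a + T g a') /\
    (exists M : C, forall a : fib A g, `|T g a| <= M * `|a|).

(* positive definiteness: sum_{i,j} b_i T_{g_i^-1 g_j}(a_i^* a_j) b_j^* >= 0 in B_e.
   Each term lies in the fibre over phi(g_i) phi(g_i^-1 g_j) phi(g_j)^-1 = e;
   c i j denotes that term viewed as an element of B_e. *)
Definition pos_def (G H : DGroup) (A : UFellBundle G) (B : UFellBundle H)
    (phi : G -> H) (T : forall g : G, fib A g -> fib B (phi g)) : Prop :=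
  forall (n : nat) (g : 'I_n -> G) (a : forall i, fib A (g i))
         (b : forall i, fib B (phi (g i))) (c : 'I_n -> 'I_n -> fib B gone),
    (forall i j, existT (fib B) _
        (fmul B (fmul B (b i) (T _ (fmul A (fstar A (a i)) (a j)))) (fstar B (b j)))
        = existT (fib B) gone (c i j)) ->
    positive_e (@fmul H B) (@fstar H B) (funit B) (\sum_(i < n) \sum_(j < n) c i j).

Record HilbertBundle (H : DGroup) (B : UFellBundle H) := {
  hfib : H -> completeNormedModType C;
  hact : forall r s, hfib r -> fib B s -> hfib (gm r s);
  hip : forall r s, hfib r -> hfib s -> fib B (gm (ginv r) s);
  hact_linl : forall r s (k : C) (x x' : hfib r) (b : fib B s),
      hact (k *: x + x') b = k *: hact x b + hact x' b;
  hact_linr : forall r s (k : C) (x : hfib r) (b b' : fib B s),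
      hact x (k *: b + b') = k *: hact x b + hact x b';
  hip_linr : forall r s (k : C) (x : hfib r) (y y' : hfib s),
      hip x (k *: y + y') = k *: hip x y + hip x y';
  hip_act : forall r s t (x : hfib r) (y : hfib s) (b : fib B t),
      existT (fib B) _ (hip x (hact y b)) = existT (fib B) _ (fmul B (hip x y) b);
  hip_star : forall r s (x : hfib r) (y : hfib s),
      existT (fib B) _ (fstar B (hip x y)) = existT (fib B) _ (hip y x);
  hip_pos : forall r (x : hfib r), Bpos (existT (fib B) _ (hip x x));
  hip_def : forall r (x : hfib r), hip x x = 0 -> x = 0;
  hnorm : forall r (x : hfib r), `|x| ^+ 2 = `|hip x x| }.
Arguments hfib {H B} h. Arguments hact {H B} h {r s}. Arguments hip {H B} h {r s}.

Definition is_action (G H : DGroup) (A : UFellBundle G) (B : UFellBundle H)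
    (phi : G -> H) (X : HilbertBundle B)
    (rho : forall g h, fib A g -> hfib X h -> hfib X (gm (phi g) h)) : Prop :=
  (forall g h (k : C) (a a' : fib A g) (x : hfib X h),
      rho _ _ (k *: a + a') x = k *: rho _ _ a x + rho _ _ a' x) /\
  (forall g h (k : C) (a : fib A g) (x x' : hfib X h),
      rho _ _ a (k *: x + x') = k *: rho _ _ a x + rho _ _ a x') /\
  (forall g g' h (a : fib A g) (a' : fib A g') (x : hfib X h),
      existT (hfib X) _ (rho _ _ (fmul A a a') x)
      = existT (hfib X) _ (rho _ _ a (rho _ _ a' x))) /\
  (forall g h k (a : fib A g) (x : hfib X h) (y : hfib X k),
      existT (fib B) _ (hip X (rho _ _ a x) y)
      = existT (fib B) _ (hip X x (rho _ _ (fstar A a) y))) /\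
  (forall g h s (a : fib A g) (x : hfib X h) (b : fib B s),
      existT (hfib X) _ (hact X (rho _ _ a x) b)
      = existT (hfib X) _ (rho _ _ a (hact X x b))).

(* Main.v *)
(* The bundle [X] is a reproducing kernel (GNS/KSGNS) construction: its fibre
   at [h] consists of functions [f] with [f(a)] in the fibre of [B] at
   [phi(g)^-1 h] for [a] in the fibre of [A] at [g], namely the closure of the
   functions [a |-> sum_j T(a^* a_j) b_j] in the dual norm; [A] acts by
   [(rho(a) f)(a') = f(a^* a')], [B] acts on values, and [xi] is [a |-> T(a^* )].

   The point is positivity of [Q = sum_ij b_i^* T(a_i^* a_j) b_j] for [b_i] of
   degree [phi(g_i)^-1 h] with arbitrary [h], as positive definiteness only
   gives [h = e].  Induct on the number of terms.  If [g_0 = e], then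
   [d Q d^* >= 0] for all [d] of degree [h] by positive definiteness.  Let [N]
   be the negative part of [Q]; taking [d = b_0 N] yields [b_0 N = 0], so that
   [N Q N] only involves the terms [i, j > 0] and is positive by induction;
   hence [N = 0].  In general write [1 = q^2 + c^* c] with [c] proportional to
   [a_0^*]; iterating, [Q] is a sum of terms for the families [c q^j a_i],
   whose first entry has degree [e], plus the term for [q^n a_i], where
   [q^n a_0 -> 0], so that the latter is in the limit covered by induction.

   The C*-algebra needed is elementary: square roots come from the iteration
   [y <- (x + y^2) / 2], and positivity in the spectral sense is matched with
   being a square through the estimate [|(1 - p) p^n| <= 1 / (n + 1)]. *)

(* Degrees other than the unit are delicate because the fibre of [B] at [h] may be small, even zero:
   the inequalities [d Q d^* >= 0] for [d] in that fibre see only the part of [Q] which the fibre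
   reaches, so alone they cannot yield [Q >= 0]. What helps is that the coefficient of an entry of
   degree [e] itself lies in that fibre, and is exactly the element needed to detach this entry from
   [N]. Other entries are moved to degree [e] by multiplication with elements of [A], up to a
   remainder that tends to 0. Functions replace equivalence classes in a completion: null vectors
   vanish as functions, and limits are taken pointwise. A second difficulty is that every product
   lives in a fibre of its own. The fibres of [B] are therefore embedded in a single *-ring, where
   degrees are predicates rather than types and calculations are ring identities. *)
Require Import Defs.
From HB Require Import structures.
From mathcomp Require Import all_boot all_order all_algebra.
From mathcomp Require Import complex.
From mathcomp Require Import all_classical all_reals all_analysis.
From mathcomp Require Import Rstruct Rstruct_topology.
From mathcomp Require Import ring lra.
Import Order.TTheory GRing.Theory Num.Theory.
Set Implicit Arguments. Unset Strict Implicit. Unset Printing Implicit Defensive.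
Local Open Scope ring_scope.
Local Open Scope complex_scope.
Local Notation R := Rdefinitions.R.

(** * Identities in abelian groups *)

(* [ring] only handles commutative rings; [abel] decides identities of abelian
   groups by comparing the integer coefficients of syntactic atoms. *)
Inductive zexpr := ZVar of nat | Zero | ZAdd of zexpr & zexpr | ZOpp of zexpr.

Fixpoint zeval (V : zmodType) (env : seq V) (e : zexpr) : V :=
  match e with
  | ZVar n => nth 0 env n
  | Zero => 0
  | ZAdd a b => zeval env a + zeval env b
  | ZOpp a => - zeval env a
  end.

Fixpoint zcoef (e : zexpr) (n : nat) : int :=
  match e with
  | ZVar m => if m == n then 1 else 0
  | Zero => 0
  | ZAdd a b => zcoef a n + zcoef b n
  | ZOpp a => - zcoef a n
  end.

Lemma zevalE (V : zmodType) (env : seq V) e :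
  zeval env e = \sum_(i < size env) nth 0 env i *~ zcoef e i.
Proof.
elim: e => [n||a IHa b IHb|a IHa] /=.
- have [nlt|nge] := ltnP n (size env).
    rewrite (bigD1 (Ordinal nlt)) //= eqxx big1 ?addr0 // => i ni.
    by rewrite ifN // eq_sym; move: ni; rewrite -val_eqE.
  rewrite nth_default // big1 // => i _; rewrite ifN //.
  by apply: contraTN nge => /eqP ->; rewrite -ltnNge.
- by rewrite big1.
- by rewrite IHa IHb -big_split; apply: eq_bigr => i _; rewrite mulrzDr.
- by rewrite IHa -sumrN; apply: eq_bigr => i _; rewrite mulrNz.
Qed.

Lemma zeval_eq (V : zmodType) (env : seq V) a b :
  [seq zcoef a i | i <- iota 0 (size env)] = [seq zcoef b i | i <- iota 0 (size env)] ->
  zeval env a = zeval env b.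
Proof.
move=> /eq_in_map h; rewrite !zevalE; apply: eq_bigr => i _.
by rewrite h // mem_iota add0n ltn_ord.
Qed.

Ltac zsame x y :=
  lazymatch x with
  | ?a * ?b => lazymatch y with ?c * ?d => zsame a c; zsame b d end
  | ?k *: ?b => lazymatch y with ?l *: ?d => unify k l; zsame b d end
  | 1 => lazymatch y with 1 => idtac end
  | ?a *+ ?n => lazymatch y with ?b *+ ?m => constr_eq n m; zsame a b end
  | ?a ^+ ?n => lazymatch y with ?b ^+ ?m => constr_eq n m; zsame a b end
  | _ => constr_eq x y
  end.
Ltac zatom env x :=
  lazymatch env with
  | nil => constr:(0%N)
  | ?y :: ?l => match constr:(tt) with
     | _ => let _ := match constr:(tt) with _ => zsame x y end in constr:(0%N)
     | _ => let n := zatom l x in constr:(n.+1)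
     end
  end.
Ltac zmem env x :=
  lazymatch env with
  | nil => fail
  | ?y :: ?l => first [zsame x y | zmem l x]
  end.
Ltac zenv env x :=
  lazymatch x with
  | ?a + ?b => let e := zenv env a in zenv e b
  | - ?a => zenv env a
  | 0 => env
  | _ => match constr:(tt) with
     | _ => let _ := match constr:(tt) with _ => zmem env x end in env
     | _ => constr:(x :: env)
     end
  end.
Ltac zreify env x :=
  lazymatch x with
  | ?a + ?b => let u := zreify env a in let v := zreify env b in constr:(ZAdd u v)
  | - ?a => let u := zreify env a in constr:(ZOpp u)
  | 0 => constr:(Zero)
  | _ => let n := zatom env x in constr:(ZVar n)
  end.
Ltac abel :=
  rewrite ?mulr2n;
  lazymatch goal with
  | |- @eq ?T ?x ?y =>
    let e0 := constr:(@nil T) in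
    let e1 := zenv e0 x in let env := zenv e1 y in
    let u := zreify env x in let v := zreify env y in
    apply: (@zeval_eq _ env u v); by vm_compute
  end.

Ltac ncring_simpl := rewrite ?(mulrDl, mulrDr, mulrBl, mulrBr, mulrN, mulNr,
  mulr0, mul0r, mulr1, mul1r, mulrA, opprD, opprK).
Ltac ncring := ncring_simpl; abel.
Ltac ilra := intros; lra.
Ltac inra := intros; nra.

(** * Complex normed spaces with real-valued norms *)

Section RealNorm.
Variable V : normedModType C.
Implicit Types x y : V.

(** Norms over [C] are themselves elements of [C]; by [nrE] the real part loses nothing, and it
    makes real arithmetic available. *)
Definition nr x : R := complex.Re `|x|.

Lemma nrE x : `|x| = ((nr x)%:C : C).
Proof.
have := normr_ge0 x; rewrite /nr; case: (`|x|) => a b /=.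
by rewrite lecE /= => /andP[/eqP ->].
Qed.

Lemma nr_ge0 x : 0 <= nr x.
Proof. by rewrite -lecR -nrE normr_ge0. Qed.

Lemma nr_le x (r : R) : (nr x <= r) = (`|x| <= (r%:C : C)).
Proof. by rewrite nrE lecR. Qed.

Lemma nr0 : nr 0 = 0.
Proof. by rewrite /nr normr0. Qed.

Lemma nr_eq0 x : nr x = 0 -> x = 0.
Proof. by move=> h; apply/eqP; rewrite -normr_eq0 nrE h. Qed.

Lemma nrD x y : nr (x + y) <= nr x + nr y.
Proof. by rewrite nr_le rmorphD /= -!nrE ler_normD. Qed.

Lemma nrN x : nr (- x) = nr x.
Proof. by rewrite /nr normrN. Qed.

Lemma nrB x y : nr (x - y) <= nr x + nr y.
Proof. by rewrite -(nrN y) nrD. Qed.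

Lemma nr_distC x y : nr (x - y) = nr (y - x).
Proof. by rewrite -nrN opprB. Qed.

Lemma nrZ (k : C) x : nr (k *: x) = complex.Re `|k| * nr x.
Proof.
rewrite /nr normrZ (nrE x) /=.
by case: `|k| => a b /=; rewrite mulr0 subr0.
Qed.

Lemma nrZR (r : R) x : nr ((r%:C : C) *: x) = `|r| * nr x.
Proof. by rewrite nrZ normc_def /= expr0n /= addr0 sqrtr_sqr. Qed.

End RealNorm.

Lemma inv_natS_small (e : R) : 0 < e -> exists n, n.+1%:R^-1 < e.
Proof.
move=> e0; have [n hn] := ltr_add_invr (y := 0) (x := e) e0.
by exists n; rewrite -[X in X < _]add0r.
Qed.

(** An explicit modulus [d] passes to the limit, so later estimates of limits are plain
    inequalities. *)
Lemma complete_seq (V : completeNormedModType C) (y : nat -> V) (d : nat -> R) :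
  (forall n m, (n <= m)%N -> nr (y m - y n) <= d n) ->
  (forall e, 0 < e -> exists n, d n < e) ->
  exists l, forall n, nr (l - y n) <= d n.
Proof.
move=> yd d0.
have cy : cauchy (y @ \oo)%classic.
  apply/cauchy_exP => e /= e0.
  have e0' : 0 < complex.Re e by move: e0; rewrite ltcE /= => /andP[].
  have [n hn] := d0 _ e0'; exists (y n).
  exists n => // m /= nm; rewrite -ball_normE /= -normrN opprB nrE.
  apply: (@le_lt_trans _ _ ((d n)%:C : C)); first by rewrite lecR yd.
  by rewrite ltcE /= hn andbT; move: e0; rewrite ltcE /= => /andP[/eqP -> _].
have cv : cvg (y @ \oo)%classic by exact: cauchy_cvg cy.
have [l yl] := (cvg_ex (y @ \oo)%classic).1 cv.
exists l => n; apply/ler_addgt0Pr => e e0.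
have ec : 0 < (e%:C : C) by rewrite ltcR.
have [N _ hN] := (cvgrPdist_lt _ _).1 yl _ ec.
have h := hN (maxn N n) (leq_maxl _ _).
have h1 : nr (l - y (maxn N n)) <= e by rewrite nr_le ltW.
rewrite -(subrK (y (maxn N n)) l) -addrA.
apply: (le_trans (nrD _ _)); rewrite [leRHS]addrC.
by apply: lerD => //; rewrite yd // leq_maxr.
Qed.

(** * Groups and total spaces of Fell bundles *)

Section Group.
Variable G : DGroup.
Implicit Types x y : G.

Lemma ginvK x : ginv (ginv x) = x.
Proof. by rewrite -[LHS]gmx1 -(gmVx x) gmA gmVx gm1x. Qed.

Lemma gmAr x y z : gm (gm x y) z = gm x (gm y z).
Proof. by rewrite gmA. Qed.

Lemma gmKV x y : gm x (gm (ginv x) y) = y.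
Proof. by rewrite gmA gmxV gm1x. Qed.

Lemma gmVK x y : gm (ginv x) (gm x y) = y.
Proof. by rewrite gmA gmVx gm1x. Qed.

Lemma gmI x y z : gm x y = gm x z -> y = z.
Proof. by move=> e; rewrite -(gmVK x y) e gmVK. Qed.

Lemma ginv_uniq x y : gm x y = gone -> y = ginv x.
Proof. by move=> e; apply: (@gmI x); rewrite e gmxV. Qed.

Lemma ginvM x y : ginv (gm x y) = gm (ginv y) (ginv x).
Proof. by apply/esym/ginv_uniq; rewrite gmAr gmKV gmxV. Qed.

Lemma ginv1 : ginv (gone : G) = gone.
Proof. by rewrite -[LHS]gmx1 gmVx. Qed.

Definition grpE := (gmAr, gmKV, gmVK, ginvM, ginvK, ginv1, gmxV, gmVx, gmx1, gm1x).
End Group.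

Section Hom.
Variables (G H : DGroup) (phi : G -> H).
Hypothesis phiM : is_hom phi.

Lemma hom1 : phi gone = gone.
Proof.
by apply: (@gmI _ (phi gone)); rewrite -phiM gm1x gmx1.
Qed.

Lemma homV x : phi (ginv x) = ginv (phi x).
Proof. by apply: ginv_uniq; rewrite -phiM gmxV hom1. Qed.

Definition homE := (hom1, homV, phiM).
End Hom.

Lemma existT_inj (I : Type) (P : I -> Type) (i : I) (x y : P i) :
  existT P i x = existT P i y -> x = y.
Proof. by move=> e; exact: (@existT_inj2 ({classic I} : eqType) P i x y e). Qed.

Local Notation tin B := (existT (fib B) _).

Section TotalSpace.
Variables (G : DGroup) (B : UFellBundle G).

Definition tot := {g : G & fib B g}.
Implicit Types s t : tot.

Definition tg s : G := projT1 s.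
Definition tm s t : tot :=
  existT (fib B) _ (fmul B (projT2 s) (projT2 t)).
Definition tst s : tot := existT (fib B) _ (fstar B (projT2 s)).
Definition nrT s : R := nr (projT2 s).
Definition tot1 : tot := existT (fib B) gone (funit B).

Lemma tmA s t r : tm s (tm t r) = tm (tm s t) r.
Proof. by rewrite /tm /= fmulA. Qed.

Lemma tstK s : tst (tst s) = s.
Proof. by case: s => g a; rewrite /tst /= fstarK. Qed.

Lemma tstM s t : tst (tm s t) = tm (tst t) (tst s).
Proof. by rewrite /tst /tm /= fstarM. Qed.

Definition trf g h (e : g = h) : fib B g -> fib B h :=
  fun a => eq_rect g (fun k => fib B k : Type) a h e.

Arguments trf {g h}.

Lemma trfE g h (e : g = h) a : existT (fib B) h (trf e a) = existT (fib B) g a.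
Proof. by case: h / e. Qed.

Lemma fibI g (a b : fib B g) :
  existT (fib B) g a = existT (fib B) g b -> a = b.
Proof. exact: existT_inj. Qed.

Lemma trfD g h (e : g = h) k a b : trf e (k *: a + b) = k *: trf e a + trf e b.
Proof. by case: h / e. Qed.

Lemma nr_trf g h (e : g = h) a : nr (trf e a) = nr a.
Proof. by case: h / e. Qed.

Lemma fmul0l g h (b : fib B h) : fmul B (0 : fib B g) b = 0.
Proof.
have := fmul_linl 1 (0 : fib B g) 0 b; rewrite !scale1r addr0 => e.
by apply: (addrI (fmul B (0 : fib B g) b)); rewrite -e addr0.
Qed.

Lemma fmul0r g h (a : fib B g) : fmul B a (0 : fib B h) = 0.
Proof.
have := fmul_linr 1 a (0 : fib B h) 0; rewrite !scale1r addr0 => e.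
by apply: (addrI (fmul B a (0 : fib B h))); rewrite -e addr0.
Qed.

Lemma fstar0 g : fstar B (0 : fib B g) = 0.
Proof.
have := fstar_conjlin 1 (0 : fib B g) 0.
rewrite rmorph1 !scale1r addr0 => e.
by apply: (addrI (fstar B (0 : fib B g))); rewrite -e addr0.
Qed.

Lemma nr_eqT g h (a : fib B g) (b : fib B h) :
  existT (fib B) g a = existT (fib B) h b -> nr a = nr b.
Proof.
move=> e; have gh := existT_inj1 e; case: h / gh b e => b e.
by rewrite (fibI e).
Qed.

Lemma nr_fmul g h (a : fib B g) (b : fib B h) : nr (fmul B a b) <= nr a * nr b.
Proof. by rewrite nr_le rmorphM /= -!nrE fmul_norm. Qed.

Lemma nr_Cstar g (a : fib B g) : nr (fmul B (fstar B a) a) = nr a ^+ 2.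
Proof.
by rewrite /nr fCstar nrE -rmorphXn.
Qed.

Lemma nr_Cstar' g (a : fib B g) : nr (fmul B a (fstar B a)) = nr (fstar B a) ^+ 2.
Proof.
rewrite -nr_Cstar; apply: nr_eqT.
by rewrite -[LHS]/(tm (tin B a) (tst (tin B a))) -{1}[tin B a]tstK.
Qed.

Lemma nr_fstar g (a : fib B g) : nr (fstar B a) = nr a.
Proof.
have le g' (b : fib B g') : nr b <= nr (fstar B b).
  have := nr_fmul (fstar B b) b; rewrite nr_Cstar expr2.
  have := nr_ge0 b; rewrite le_eqVlt => /orP[/eqP <- _|b0].
    exact: nr_ge0.
  by rewrite ler_pM2r.
apply/eqP; rewrite eq_le le andbT (le_trans (le _ _)) //.
by rewrite (nr_eqT (fstarK a)).
Qed.

Lemma tm1e (a : fib B gone) : tm tot1 (tin B a) = tin B a.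
Proof. exact: funit_l. Qed.

(** The axioms make [funit] a unit on the fibre at [gone]. For [z = 1 a - a] and [w = z^*], the
    product [a w] lies there, so [z w = 1 (a w) - a w = 0], and the C*-identity gives [z = 0]. *)
Lemma tm1s s : tm tot1 s = s.
Proof.
case: s => g a; set z : fib B g := trf (gm1x g) (fmul B (funit B) a) - a.
have zz : fmul B z (fstar B z) = 0.
  have -> : z = (-1) *: a + trf (gm1x g) (fmul B (funit B) a).
    by rewrite addrC scaleN1r.
  rewrite fmul_linl scaleN1r; apply/eqP; rewrite addrC subr_eq0; apply/eqP.
  set w := fstar B _; apply: fibI.
  have e : gm g (ginv g) = gone by rewrite gmxV.
  rewrite -[LHS]/(tm (tin B _) (tin B w)) trfE.
  rewrite -[LHS]/(tm (tm tot1 (tin B a)) (tin B w)) -tmA.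
  rewrite -[RHS]/(tm (tin B a) (tin B w)).
  set y := tm (tin B a) _.
  have -> : y = existT (fib B) gone (trf e (projT2 y)) by rewrite trfE.
  exact: tm1e.
have z0 : z = 0.
  apply: nr_eq0; rewrite -nr_fstar; apply/eqP.
  by rewrite -sqrf_eq0 -nr_Cstar' zz nr0.
rewrite -[LHS](trfE (gm1x g)); congr existT.
by apply/eqP; rewrite -subr_eq0; apply/eqP.
Qed.

Lemma tst1 : tst tot1 = tot1.
Proof.
by rewrite -[LHS]tm1s -{1}(tstK tot1) -tstM tm1s tstK.
Qed.

Lemma tms1 s : tm s tot1 = s.
Proof. by rewrite -[LHS]tstK tstM tst1 tm1s tstK. Qed.

End TotalSpace.
Arguments trf {G B g h}.

(** * The unit fibre as a ring *)

Section UnitFibre.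
Variables (G : DGroup) (B : UFellBundle G).

Definition fe : Type := fib B gone.
HB.instance Definition _ := CompleteNormedModule.copy fe (fib B gone).
Implicit Types x y z : fe.

Definition femul x y : fe := trf (gm1x gone) (fmul B x y).
Definition cstar x : fe := trf (ginv1 G) (fstar B x).

Lemma femulE x y : tin B (femul x y) = tm (tin B x) (tin B y).
Proof. exact: trfE. Qed.

Lemma cstarE x : tin B (cstar x) = tst (tin B x).
Proof. exact: trfE. Qed.

Lemma femulA : associative femul.
Proof. by move=> x y z; apply: fibI; rewrite !femulE tmA. Qed.
Lemma femul1 : left_id (funit B : fe) femul.
Proof. by move=> x; apply: fibI; rewrite femulE tm1s. Qed.
Lemma fe1mul : right_id (funit B : fe) femul.
Proof. by move=> x; apply: fibI; rewrite femulE tms1. Qed.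
Lemma femulDl : left_distributive femul +%R.
Proof.
move=> x y z; rewrite /femul -[x in x + y]scale1r fmul_linl trfD.
by rewrite scale1r.
Qed.
Lemma femulDr : right_distributive femul +%R.
Proof.
move=> x y z; rewrite /femul -[y in y + z]scale1r fmul_linr trfD.
by rewrite scale1r.
Qed.
HB.instance Definition _ := GRing.Zmodule_isPzRing.Build fe
  femulA femul1 fe1mul femulDl femulDr.

Lemma tinM x y : tin B (x * y) = tm (tin B x) (tin B y).
Proof. exact: femulE. Qed.

Lemma feZAl (k : C) x y : k *: (x * y) = (k *: x) * y.
Proof.
by rewrite /GRing.mul /= /femul -[in RHS](addr0 (k *: x)) fmul_linl fmul0l trfD
  (_ : trf _ 0 = 0) ?addr0 //; apply: nr_eq0; rewrite nr_trf nr0.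
Qed.
Lemma feZAr (k : C) x y : k *: (x * y) = x * (k *: y).
Proof.
by rewrite /GRing.mul /= /femul -[in RHS](addr0 (k *: y)) fmul_linr fmul0r trfD
  (_ : trf _ 0 = 0) ?addr0 //; apply: nr_eq0; rewrite nr_trf nr0.
Qed.

Lemma cstarM x y : cstar (x * y) = cstar y * cstar x.
Proof. by apply: fibI; rewrite cstarE femulE tstM femulE !cstarE. Qed.
Lemma cstar1 : cstar 1 = 1.
Proof. by apply: fibI; rewrite cstarE; exact: tst1. Qed.
Lemma cstarlin (k : C) x y : cstar (k *: x + y) = k^* *: cstar x + cstar y.
Proof. by rewrite /cstar fstar_conjlin trfD. Qed.
Lemma cstar0 : cstar 0 = 0.
Proof. by apply: nr_eq0; rewrite nr_trf fstar0 nr0. Qed.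
Lemma cstarD x y : cstar (x + y) = cstar x + cstar y.
Proof. by rewrite -[x in LHS]scale1r cstarlin rmorph1 scale1r. Qed.
Lemma cstarZ (k : C) x : cstar (k *: x) = k^* *: cstar x.
Proof. by rewrite -[k *: x]addr0 cstarlin cstar0 addr0. Qed.
Lemma cstarN x : cstar (- x) = - cstar x.
Proof. by rewrite -scaleN1r cstarZ rmorphN rmorph1 scaleN1r. Qed.
Lemma cstarB x y : cstar (x - y) = cstar x - cstar y.
Proof. by rewrite cstarD cstarN. Qed.

Lemma nr_feM x y : nr (x * y) <= nr x * nr y.
Proof. by rewrite [nr (x * y)]nr_trf nr_fmul. Qed.
Lemma nr_cstar x : nr (cstar x) = nr x.
Proof. by rewrite nr_trf nr_fstar. Qed.
Lemma nr_feC x : nr (cstar x * x) = nr x ^+ 2.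
Proof.
rewrite -nr_Cstar; apply: nr_eqT.
by rewrite femulE cstarE.
Qed.
End UnitFibre.

(** * Square roots *)

Local Notation "r :*: x" := ((r%:C : C) *: x) (at level 40, left associativity).

Lemma rscaleA (V : lmodType C) (a b : R) (x : V) : a :*: (b :*: x) = (a * b) :*: x.
Proof. by rewrite scalerA -rmorphM. Qed.
Lemma rscaleDl (V : lmodType C) (a b : R) (x : V) : (a + b) :*: x = a :*: x + b :*: x.
Proof. by rewrite -scalerDl -rmorphD. Qed.
Lemma rscaleNl (V : lmodType C) (a : R) (x : V) : (- a) :*: x = - (a :*: x).
Proof. by rewrite -scaleNr -rmorphN. Qed.
Lemma rscaleBl (V : lmodType C) (a b : R) (x : V) : (a - b) :*: x = a :*: x - b :*: x.
Proof. by rewrite rscaleDl rscaleNl. Qed.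
Lemma rscale1 (V : lmodType C) (x : V) : 1 :*: x = x.
Proof. by rewrite scale1r. Qed.
Lemma rscale0 (V : lmodType C) (x : V) : 0 :*: x = 0.
Proof. by rewrite scale0r. Qed.

Section SquareRoot.

(** The iteration of [rootseq] at the scalar 1, used as a majorant. Its limit 1 is a double root of
    [t = (1 + t^2) / 2], so the error decays only like [1 / n]. *)
Fixpoint newt (n : nat) : R := if n is n'.+1 then 2^-1 * (1 + newt n' ^+ 2) else 0.

Lemma newt_bnd n : [/\ 0 <= newt n, newt n <= 1 & 1 - newt n <= 2 / n.+2%:R].
Proof.
elim: n => [|n [h0 h1 h2]] /=; first by split; ilra.
have e : 1 - 2^-1 * (1 + newt n ^+ 2) = (1 - newt n) - 2^-1 * (1 - newt n)^+2 by field.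
split; [nra|nra|rewrite e].
move: h2; set d := 1 - newt n => h2.
have d1 : d <= 1 by rewrite /d; ilra.
have d0 : 0 <= d by rewrite /d; ilra.
have n0 : 0 <= n%:R :> R by rewrite ler0n.
have -> : n.+3%:R = n%:R + 3 :> R by rewrite -addn3 natrD.
move: h2; have -> : n.+2%:R = n%:R + 2 :> R by rewrite -addn2 natrD.
move: n0; set N : R := n%:R => n0 h2.
set u := 2 / (N + 2) in h2.
have uN : u * (N + 2) = 2 by rewrite /u; field; ilra.
have u1 : u <= 1 by nra.
(* [d - d^2 / 2] increases on [[0, 1]], so the bound [u] may replace [d]. *)
have l1 : d - 2^-1 * d ^+ 2 <= u - 2^-1 * u ^+ 2 by nra.
apply: (le_trans l1); rewrite ler_pdivlMr; last lra.
have u0 : 0 <= u by nra.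
have -> : (u - 2^-1 * u ^+ 2) * (N + 3) = (1 - 2^-1 * u) * (u * (N + 2) + u) by field.
rewrite uN (_ : _ * _ = 2 - 2^-1 * u ^+ 2); last by field.
by have := sqr_ge0 u; ilra.
Qed.

Lemma newt_mono n : newt n <= newt n.+1.
Proof. have [h0 h1 _] := newt_bnd n => /=; inra. Qed.

Lemma newt_small (e : R) : 0 < e -> exists n, 1 - newt n < e.
Proof.
move=> e0; have [n hn] := inv_natS_small (e := e / 2) ltac:(lra).
exists n; have [_ _ h] := newt_bnd n; apply: (le_lt_trans h).
have l : (n.+2%:R : R)^-1 <= n.+1%:R^-1.
  by rewrite lef_pV2 ?posrE ?ltr0n // ler_nat.
move: l hn; move: (n.+2%:R^-1) (n.+1%:R^-1); ilra.
Qed.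

Variables (G : DGroup) (B : UFellBundle G).
Local Notation E := (fe B).
Implicit Types x y z q : E.

Lemma cstarZR (r : R) x : cstar (r :*: x) = r :*: cstar x.
Proof. by rewrite cstarZ; congr (_ *: _); apply/eqP; rewrite eq_complex /= oppr0 !eqxx. Qed.

Lemma newt0 x c : (forall n, nr x <= c * (1 - newt n)) -> x = 0.
Proof.
move=> h; apply: nr_eq0; apply/eqP; rewrite eq_le nr_ge0 andbT.
apply/ler_addgt0Pr => e e0; rewrite add0r.
have c1 : 0 < `|c| + 1 by have := normr_ge0 c; ilra.
have [n hn] := newt_small (e := e / (`|c| + 1)) ltac:(by apply: divr_gt0).
apply: (le_trans (h n)); have [_ n1 _] := newt_bnd n.
have cc := ler_norm c.
have k : (1 - newt n) * (`|c| + 1) < e by rewrite -ltr_pdivlMr.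
nra.
Qed.

Fixpoint rootseq x (n : nat) : E :=
  if n is n'.+1 then 2^-1 :*: (x + rootseq x n' * rootseq x n') else 0.

Lemma half_abs : `|2^-1 : R| = 2^-1.
Proof. by rewrite ger0_norm //; ilra. Qed.

(** Writing [a a - b b] as [a (a - b) + (a - b) b] needs no commutation, and [newt] satisfies the
    same identity, so the norms are dominated term by term. *)
Lemma rootseq_bnd x n : nr x <= 1 ->
  nr (rootseq x n) <= newt n /\
  nr (rootseq x n.+1 - rootseq x n) <= newt n.+1 - newt n.
Proof.
move=> x1; have h n' : nr (rootseq x n') <= newt n'.
  elim: n' => [|n' IH] /=; first by rewrite nr0.
  rewrite nrZR half_abs ler_pM2l; last lra.
  apply: (le_trans (nrD _ _)); apply: lerD => //.
  apply: (le_trans (nr_feM _ _)); rewrite expr2.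
  by apply: ler_pM => //; apply: nr_ge0.
split => //; elim: n => [|n IH].
  rewrite /= !subr0 mulr0 addr0 nrZR half_abs expr0n /=; ilra.
set a := rootseq x n.+1 in IH; set b := rootseq x n in IH.
have -> : rootseq x n.+2 - rootseq x n.+1 = 2^-1 :*: (a * (a - b) + (a - b) * b).
  rewrite -[rootseq x n.+2]/(2^-1 :*: (x + a * a)).
  rewrite -[rootseq x n.+1]/(2^-1 :*: (x + b * b)) -scalerBr; congr (_ *: _).
  ncring.
have -> : newt n.+2 - newt n.+1 = 2^-1 * (newt n.+1 * (newt n.+1 - newt n) + (newt n.+1 - newt n) * newt n).
  rewrite -[newt n.+2]/(2^-1 * (1 + newt n.+1 ^+ 2)).
  by rewrite -{2}[newt n.+1]/(2^-1 * (1 + newt n ^+ 2)); field.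
rewrite nrZR half_abs ler_pM2l; last lra.
apply: (le_trans (nrD _ _)); apply: lerD; apply: (le_trans (nr_feM _ _));
  by apply: ler_pM; rewrite ?nr_ge0 //; exact: h.
Qed.

(** The limit [l] of [rootseq] satisfies [l = (x + l^2) / 2], that is [(1 - l)^2 = 1 - x]. The bound
    on [1 - s] records that the root is the positive one, in the form used by [psd_of_norm]. *)
Lemma sqrt_exists x : cstar x = x -> nr x <= 1 ->
  exists s, [/\ cstar s = s, s * s = 1 - x, nr (1 - s) <= 1 &
    forall z, z * x = x * z -> z * s = s * z].
Proof.
move=> xs x1; pose y := rootseq x.
have yb n : nr (y n) <= newt n by case: (rootseq_bnd n x1).
have yd n m : (n <= m)%N -> nr (y m - y n) <= 1 - newt n.
  move=> nm; apply: (@le_trans _ _ (newt m - newt n)).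
    elim: m nm => [|m IH]; first by rewrite leqn0 => /eqP ->; rewrite !subrr nr0.
    rewrite leq_eqVlt => /orP[/eqP ->|]; first by rewrite !subrr nr0.
    rewrite ltnS => /IH h; have [_ h'] := rootseq_bnd m x1.
    have -> : y m.+1 - y n = (y m.+1 - y m) + (y m - y n) by abel.
    by apply: (le_trans (nrD _ _)); rewrite /y; move: h h'; rewrite /y; ilra.
  by have [_ h _] := newt_bnd m; rewrite lerD2r.
have [l hl] := @complete_seq (fib B gone) y (fun n => 1 - newt n) yd newt_small.
have {}hl : forall n, nr ((l : E) - y n) <= 1 - newt n := hl.
move: l hl => l; change (fe B) in l => hl.
have l1 : nr l <= 1.
  have -> : l = (l - y 0%N) + y 0%N by abel.
  by have := hl 0%N; have := nrD (l - y 0%N) (y 0%N); have := yb 0%N; rewrite /=; ilra.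
have ge0 n : 0 <= 1 - newt n by have [_ h _] := newt_bnd n; ilra.
have fix1 : l = 2^-1 :*: (x + l * l).
  apply/eqP; rewrite -subr_eq0; apply/eqP; apply: (@newt0 _ 2) => n.
  have -> : l - 2^-1 :*: (x + l * l) =
      (l - y n.+1) - 2^-1 :*: (l * (l - y n) + (l - y n) * y n).
    rewrite -[y n.+1]/(2^-1 :*: (x + y n * y n)).
    have -> : l * (l - y n) + (l - y n) * y n = (x + l * l) - (x + y n * y n) by ncring.
    rewrite [in RHS]scalerBr; abel.
  apply: (le_trans (nrB _ _)); rewrite nrZR half_abs.
  have a1 : nr (l * (l - y n)) <= 1 - newt n.
    apply: (le_trans (nr_feM _ _)); rewrite -[leRHS]mul1r.
    by apply: ler_pM; rewrite ?nr_ge0.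
  have a2 : nr ((l - y n) * y n) <= 1 - newt n.
    apply: (le_trans (nr_feM _ _)); rewrite -[leRHS]mulr1.
    by apply: ler_pM; rewrite ?nr_ge0 //; have [_ h _] := newt_bnd n; apply: le_trans h.
  have := hl n.+1; have := newt_mono n.
  have := nrD (l * (l - y n)) ((l - y n) * y n).
  by move: a1 a2; rewrite -[newt n.+1]/(newt (S n)); ilra.
exists (1 - l); split.
- rewrite cstarB cstar1; congr (_ - _); apply/eqP; rewrite -subr_eq0; apply/eqP.
  apply: (@newt0 _ 2) => n.
  have ys : cstar (y n) = y n.
    by elim: (n) => [|m IH] /=; rewrite ?cstar0 // cstarZR cstarD xs cstarM IH.
  have -> : cstar l - l = cstar (l - y n) - (l - y n) by rewrite cstarB ys; abel.
  by apply: (le_trans (nrB _ _)); rewrite nr_cstar; have := hl n; ilra.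
- have e : l + l = x + l * l.
    by rewrite {1 2}fix1 -rscaleDl (_ : 2^-1 + 2^-1 = 1 :> R) ?rscale1 //; field.
  have -> : (1 - l) * (1 - l) = 1 - (l + l) + l * l by ncring.
  by rewrite e; abel.
- by have -> : 1 - (1 - l) = l by abel.
- move=> z zx; have zy n : z * y n = y n * z.
    elim: n => [|n IH] /=; first by rewrite mulr0 mul0r.
    rewrite -feZAr -feZAl; congr (_ *: _).
    by rewrite mulrDr mulrDl zx mulrA IH -mulrA IH mulrA.
  suff : z * l = l * z by move=> e; rewrite mulrBr mulrBl e mulr1 mul1r.
  apply/eqP; rewrite -subr_eq0; apply/eqP; apply: (@newt0 _ (2 * nr z)) => n.
  have -> : z * l - l * z = z * (l - y n) - (l - y n) * z.
    by rewrite mulrBr mulrBl zy; abel.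
  apply: (le_trans (nrB _ _)).
  have := nr_feM z (l - y n); have := nr_feM (l - y n) z.
  have := hl n; have := nr_ge0 z; inra.
Qed.
End SquareRoot.

(** * Positive elements of the unit fibre *)

Lemma sqrtr_sqrt (r : R) : 0 <= r -> Num.sqrt r * Num.sqrt r = r.
Proof. by move=> r0; rewrite -expr2 sqr_sqrtr. Qed.

Section Positive.
Variables (G : DGroup) (B : UFellBundle G).
Local Notation E := (fe B).
Implicit Types x y z q p D N : E.

Lemma nr_fe1 : nr (1 : E) <= 1.
Proof.
have := nr_feC (1 : E); rewrite cstar1 mulr1 expr2.
have := nr_ge0 (1 : E); inra.
Qed.

Lemma nr_sqr_sa q : cstar q = q -> nr (q * q) = nr q ^+ 2.
Proof. by move=> qs; rewrite -nr_feC qs. Qed.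

Lemma rscaleMl (r : R) x y : (r :*: x) * y = r :*: (x * y).
Proof. by rewrite feZAl. Qed.
Lemma rscaleMr (r : R) x y : x * (r :*: y) = r :*: (x * y).
Proof. by rewrite feZAr. Qed.

(* [q + i s] is unitary, and [q] is its real part. *)
Lemma nr_cos_le1 q s : cstar q = q -> cstar s = s -> q * s = s * q ->
  q * q + s * s = 1 -> nr q <= 1.
Proof.
move=> qa sa qs e; pose i : C := 'i%C; pose u : E := q + i *: s.
have ii : i * i = -1 by rewrite /i -expr2 sqr_i.
have ca : cstar u = q - i *: s.
  rewrite /u cstarD cstarZ qa sa -scaleNr; congr (_ + _ *: _).
  by apply/eqP; rewrite eq_complex /= oppr0 !eqxx.
have uu : cstar u * u = 1.
  rewrite ca /u -e; ncring_simpl.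
  rewrite -!(feZAl, feZAr) scalerA ii qs scaleN1r; abel.
have u1 : nr u <= 1.
  have := nr_feC u; rewrite uu expr2; have := nr_fe1; have := nr_ge0 u; inra.
have -> : q = 2^-1 :*: (u + cstar u).
  rewrite ca /u (_ : _ + _ = q + q); last by abel.
  by rewrite scalerDr -rscaleDl (_ : 2^-1 + 2^-1 = 1 :> R) ?rscale1 //; field.
rewrite nrZR half_abs; have := nrD u (cstar u); rewrite nr_cstar; lra.
Qed.

(** Being a square is the working form of positivity. For self-adjoint [x] and any [t >= nr x] it is
    equivalent to [nr (t - x) <= t], which handles sums and limits, and also to the spectral
    condition of [positive_e]. *)
Definition psd x := exists2 q, cstar q = q & x = q * q.

Lemma psd_sa x : psd x -> cstar x = x.
Proof. by move=> [q qs ->]; rewrite cstarM qs. Qed.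

(** With [s] a root of [1 - q q], the pair [s], [q] is a cosine and a sine, so [nr s <= 1]. *)
Lemma nr_1Bsqr q : cstar q = q -> nr q <= 1 -> nr (1 - q * q) <= 1.
Proof.
move=> qs q1.
have [||s [ss s2 _ sc]] := @sqrt_exists _ _ (q * q).
- by rewrite cstarM qs.
- by rewrite nr_sqr_sa // expr_le1 ?nr_ge0.
have qsc : q * s = s * q by apply: sc; rewrite mulrA.
have s1 : nr s <= 1.
  by apply: (@nr_cos_le1 s q) => //; rewrite s2; abel.
by rewrite -s2 nr_sqr_sa // expr_le1 // nr_ge0.
Qed.

(* That [q] lies in the bicommutant of [x] replaces functional calculus: roots of
   commuting elements commute. *)
Lemma root_of_norm x (t : R) : cstar x = x -> nr (t :*: (1 : E) - x) <= t ->
  exists q, [/\ cstar q = q, x = q * q, nr ((Num.sqrt t) :*: (1 : E) - q) <= Num.sqrt t &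
    forall z, z * x = x * z -> z * q = q * z].
Proof.
move=> xs h; have t0 : 0 <= t := le_trans (nr_ge0 _) h.
move: t0; rewrite le_eqVlt => /orP[/eqP t0|t0].
  move: h; rewrite -t0 rscale0 sub0r nrN => h.
  have x0 : x = 0 by apply: nr_eq0; apply/eqP; rewrite eq_le h nr_ge0.
  by exists 0; rewrite cstar0 x0 mulr0 sqrtr0 rscale0 subr0 nr0; split => // z; rewrite mulr0 mul0r.
have ti : t^-1 * t = 1 by rewrite mulVf // gt_eqF.
have st : Num.sqrt t * Num.sqrt t = t by rewrite sqrtr_sqrt // ltW.
have s0 : 0 <= Num.sqrt t by apply: sqrtr_ge0.
have [||s [ss s2 s1 sc]] := @sqrt_exists _ _ (t^-1 :*: (t :*: (1 : E) - x)).
- by rewrite cstarZR cstarB cstarZR cstar1 xs.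
- by rewrite nrZR gtr0_norm ?invr_gt0 // ler_pdivrMl // mulr1.
have s2' : s * s = t^-1 :*: x.
  by rewrite s2 scalerBr rscaleA ti rscale1; abel.
exists (Num.sqrt t :*: s); split.
- by rewrite cstarZR ss.
- by rewrite rscaleMl rscaleMr rscaleA st s2' rscaleA mulrC ti rscale1.
- by rewrite -scalerBr nrZR ger0_norm // ler_piMr.
- move=> z zx; rewrite rscaleMl rscaleMr sc // rscaleMl rscaleMr; congr (_ *: _).
  by rewrite mulrBl mulrBr rscaleMl rscaleMr mulr1 mul1r zx.
Qed.

Lemma psd_norm x (t : R) : psd x -> nr x <= t -> nr (t :*: (1 : E) - x) <= t.
Proof.
move=> [q qs ->]; rewrite nr_sqr_sa // => h.
have t0 : 0 <= t by apply: le_trans h; rewrite exprn_ge0 // nr_ge0.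
move: t0; rewrite le_eqVlt => /orP[/eqP t0|t0].
  have q0 : q = 0.
    by apply: nr_eq0; apply/eqP; rewrite -sqrf_eq0 eq_le sqr_ge0 andbT t0.
  by rewrite -t0 q0 mulr0 rscale0 subrr nr0.
have st : Num.sqrt t * Num.sqrt t = t by rewrite sqrtr_sqrt // ltW.
have s0 : 0 < Num.sqrt t by rewrite sqrtr_gt0.
have := @nr_1Bsqr ((Num.sqrt t)^-1 :*: q); rewrite cstarZR qs nrZR.
rewrite rscaleMl rscaleMr rscaleA -invfM st gtr0_norm ?invr_gt0 //.
rewrite ler_pdivrMl // mulr1.
have le : nr q <= Num.sqrt t.
  by rewrite -(ler_pXn2r (n := 2)) ?nnegrE ?nr_ge0 ?(ltW s0) // sqr_sqrtr // ltW.
move=> /(_ erefl le); have -> : t :*: (1 : E) - q * q = t :*: (1 - t^-1 :*: (q * q)).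
  by rewrite scalerBr rscaleA mulfV ?gt_eqF // rscale1.
by rewrite nrZR gtr0_norm // => h1; rewrite -[leRHS]mulr1 ler_pM2l.
Qed.

Lemma psd_of_norm x (t : R) : cstar x = x -> nr (t :*: (1 : E) - x) <= t -> psd x.
Proof. by move=> xs /(root_of_norm xs) [q [qs e _ _]]; exists q. Qed.

Lemma psd_root x : psd x -> exists q, [/\ cstar q = q, x = q * q, psd q &
    forall z, z * x = x * z -> z * q = q * z].
Proof.
move=> px; have [q [qs e h c]] := root_of_norm (psd_sa px) (psd_norm px (lexx _)).
by exists q; split => //; exact: psd_of_norm h.
Qed.

(** A sum of squares is not visibly a square, but the norm criterion adds up by the triangle
    inequality. *)
Lemma psdD x y : psd x -> psd y -> psd (x + y).
Proof.
move=> px py; apply: (@psd_of_norm _ (nr x + nr y)).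
  by rewrite cstarD !psd_sa.
rewrite rscaleDl opprD addrACA; apply: (le_trans (nrD _ _)).
by apply: lerD; apply: psd_norm.
Qed.

Lemma psd0 : psd 0.
Proof. by exists 0; rewrite ?cstar0 ?mulr0. Qed.

Lemma psdZ (r : R) x : 0 <= r -> psd x -> psd (r :*: x).
Proof.
move=> r0 [q qs ->]; exists (Num.sqrt r :*: q); first by rewrite cstarZR qs.
by rewrite rscaleMl rscaleMr rscaleA sqrtr_sqrt.
Qed.

Lemma psd1 : psd 1.
Proof. by exists 1; rewrite ?cstar1 ?mulr1. Qed.

Lemma psd_le_nr x (t : R) : cstar x = x -> nr x <= t -> psd (t :*: (1 : E) - x).
Proof.
move=> xs h; apply: (@psd_of_norm _ t); first by rewrite cstarB cstarZR cstar1 xs.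
by have -> : t :*: (1 : E) - (t :*: (1 : E) - x) = x by abel.
Qed.

Lemma psd_comm_conj x c : psd x -> cstar c = c -> c * x = x * c -> psd (c * x * c).
Proof.
move=> /psd_root[q [qs e _ qc]] cs cx; exists (q * c).
  by rewrite cstarM qs cs qc.
by rewrite e !mulrA -(qc c) // !mulrA.
Qed.

Lemma nr_le_psd x (t : R) : 0 <= t -> psd x -> psd (t :*: (1 : E) - x) -> nr x <= t.
Proof.
move=> t0 px ptx.
(* A bound [u > t] is positive, so one may divide by [Num.sqrt u] even if [t = 0]. The commuting
   roots of [x] and [u - x] are then, after scaling, a cosine and a sine. *)
suff h (u : R) : t < u -> nr x <= u by apply/ler_addgt0Pr => e e0; apply: h; rewrite ltrDl.
move=> tu; have u0 : 0 < u by apply: le_lt_trans tu.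
have pux : psd (u :*: (1 : E) - x).
  have -> : u :*: (1 : E) - x = (u - t) :*: (1 : E) + (t :*: (1 : E) - x) by rewrite rscaleBl; abel.
  by apply: psdD => //; apply: psdZ psd1; rewrite subr_ge0 ltW.
have [q [qs qx _ qc]] := psd_root px.
have [r [rs rx _ rc]] := psd_root pux.
have qr : q * r = r * q.
  apply: rc; rewrite mulrBr mulrBl rscaleMr rscaleMl mulr1 mul1r; congr (_ - _).
  by rewrite qx mulrA.
have su : Num.sqrt u * Num.sqrt u = u by rewrite sqrtr_sqrt // ltW.
have s0 : 0 < Num.sqrt u by rewrite sqrtr_gt0.
have := @nr_cos_le1 ((Num.sqrt u)^-1 :*: q) ((Num.sqrt u)^-1 :*: r).
rewrite !cstarZR qs rs !rscaleMl !rscaleMr qr !rscaleA -invfM su -scalerDr -qx -rx.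
rewrite (_ : x + _ = u :*: (1 : E)); last by abel.
rewrite rscaleA mulVf ?gt_eqF // rscale1 => /(_ erefl erefl erefl erefl).
rewrite nrZR gtr0_norm ?invr_gt0 // ler_pdivrMl // mulr1 => h.
by rewrite qx nr_sqr_sa // -su expr2; apply: ler_pM; rewrite ?nr_ge0.
Qed.

Lemma psd_nr_mono x y : psd x -> psd (y - x) -> nr x <= nr y.
Proof.
move=> px pyx; have py : psd y by have -> : y = x + (y - x) by [abel]; apply: psdD.
apply: nr_le_psd => //; first exact: nr_ge0.
have -> : nr y :*: (1 : E) - x = (nr y :*: (1 : E) - y) + (y - x) by abel.
by apply: psdD => //; apply: psd_le_nr (lexx _); apply: psd_sa.
Qed.

Lemma psd_anti x : psd x -> psd (- x) -> x = 0.
Proof.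
move=> px pNx; apply: nr_eq0; apply/eqP; rewrite eq_le nr_ge0 andbT.
by apply: nr_le_psd; rewrite // rscale0 sub0r.
Qed.

End Positive.

(** * Negative parts and the spectral characterisation of positivity *)

Section Negative.
Variables (G : DGroup) (B : UFellBundle G).
Local Notation E := (fe B).
Implicit Types x y z q p D N : E.

Lemma rscale_nat (V : lmodType C) n (x : V) : n%:R :*: x = x *+ n.
Proof. by rewrite rmorph_nat scaler_nat. Qed.

Lemma psdM x y : psd x -> psd y -> GRing.comm x y -> psd (x * y).
Proof.
move=> /psd_root[q [qs xq _ qc]] /psd_root[r [rs yr _ rc]] xy.
have yq : y * q = q * y by apply: qc.
have qr : q * r = r * q by apply: rc.
exists (q * r); first by rewrite cstarM qs rs qr.
by rewrite xq yr -!mulrA (mulrA r q) -qr !mulrA.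
Qed.

Lemma psdX x n : psd x -> psd (x ^+ n).
Proof.
move=> px; elim: n => [|n IH]; first exact: psd1.
by rewrite exprS; apply: psdM => //; apply: commrX.
Qed.

(* [1 - (n+2)(1-p)p^(n+1) = p (1 - (n+1)(1-p)p^n) + (1-p)(1-p^(n+1))]: the
   classical bound [(1-t)t^n <= 1/(n+1)] as a sum of products of positives. *)
Lemma nr_1B_powers p n : psd p -> nr p <= 1 -> n.+1%:R * nr ((1 - p) * p ^+ n) <= 1.
Proof.
move=> pp p1.
have p1p : psd (1 - p).
  by have := psd_le_nr (psd_sa pp) p1; rewrite rscale1.
have c1 m : GRing.comm (p ^+ m) (1 - p).
  by apply: commrB; [exact: commr1 | apply: commr_sym; apply: commrX].
have psdY m : psd ((1 - p) * p ^+ m).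
  by apply: psdM => //; [exact: psdX | apply: commr_sym].
have psdF m : psd (1 - p ^+ m).
  elim: m => [|m IH]; first by rewrite expr0 subrr; exact: psd0.
  have -> : 1 - p ^+ m.+1 = (1 - p ^+ m) + (1 - p) * p ^+ m by rewrite exprS; ncring.
  exact: psdD.
have pY m : p * ((1 - p) * p ^+ m) = (1 - p) * p ^+ m.+1.
  by rewrite mulrA exprS mulrA (c1 1%N : p * _ = _).
have psdE m : psd (1 - ((1 - p) * p ^+ m) *+ m.+1).
  elim: m => [|m IH].
    by rewrite expr0 mulr1 mulr1n (_ : 1 - (1 - p) = p) //; abel.
  have -> : 1 - ((1 - p) * p ^+ m.+1) *+ m.+2 =
      p * (1 - ((1 - p) * p ^+ m) *+ m.+1) + (1 - p) * (1 - p ^+ m.+1).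
    rewrite [p * (_ - _)]mulrBr mulr1 mulrnAr pY [(1 - p) * (1 - _)]mulrBr mulr1 [in LHS]mulrS.
    by abel.
  apply: psdD; apply: psdM => //.
    apply: commrB; first exact: commr1.
    by apply: commrMn; rewrite /GRing.comm pY exprSr mulrA.
  by apply: commrB; [exact: commr1 | apply: commr_sym].
rewrite -[n.+1%:R]ger0_norm // -nrZR; apply: nr_le_psd => //.
  by apply: psdZ => //.
by rewrite rscale1 rscale_nat.
Qed.

Lemma absolute_value D : cstar D = D ->
  exists q, [/\ cstar q = q, (q * q) * (q * q) = D * D & q * D = D * q].
Proof.
move=> Ds; have DD : psd (D * D) by exists D.
have [a [as_ ea pa ac]] := psd_root DD.
have [q [qs eq_ _ qc]] := psd_root pa.
exists q; split; rewrite -?eq_ //; symmetry; apply: qc; apply: ac; exact: mulrA.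
Qed.

(* [N] is twice the negative part of [D], and [q * q] is [|D|]. *)
Lemma negative_part D : cstar D = D ->
  exists N q, [/\ cstar N = N, cstar q = q, q * N = N * q,
    D = q * q - N & N * N = (q * q * N) *+ 2].
Proof.
move=> Ds; have [q [qs e qD]] := absolute_value Ds.
have qqD : q * q * D = D * (q * q) by rewrite -mulrA qD mulrA qD mulrA.
exists (q * q - D), q; split => //.
- by rewrite cstarB cstarM qs Ds.
- by rewrite mulrBr mulrBl qD mulrA.
- by abel.
- rewrite !mulrBl !mulrBr !mulrA -[q * q * q * q]mulrA e -mulrA -qqD; ncring_simpl.
  by abel.
Qed.

Lemma sa_sqr0 x : cstar x = x -> x * x = 0 -> x = 0.
Proof.
move=> xs x0; apply: nr_eq0; apply/eqP.
by rewrite -sqrf_eq0 -nr_sqr_sa // x0 nr0.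
Qed.

Lemma cstarX x n : cstar (x ^+ n) = cstar x ^+ n.
Proof. by elim: n => [|n IH]; rewrite ?cstar1 // exprS cstarM IH exprSr. Qed.

(** With [b] the absolute value of [N], twice the negative part [M = b - N] satisfies
    [M N^3 = - M b^3]. Hence [M b^3 M] and its opposite are both positive, so it vanishes, and with
    it [M^6 = 8 b^3 M^3]. *)
Lemma psd_of_cube N : cstar N = N -> psd (N ^+ 3) -> psd N.
Proof.
move=> Ns N3; have NN : psd (N * N) by exists N.
have [b [bs eb pb bc]] := psd_root NN.
have Nb : GRing.comm N b by apply: bc; rewrite mulrA.
set M := b - N.
have Ms : cstar M = M by rewrite /M cstarB bs Ns.
have bM : GRing.comm b M by apply: commrB => //; exact: commr_sym.
have NM : GRing.comm N M by apply: commrB.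
have MN : M * N = - (M * b) by rewrite /M !mulrBl eb Nb; abel.
have MM : M ^+ 2 = (b * M) *+ 2.
  by rewrite expr2 {2}/M mulrBr MN bM; abel.
have h1 : psd (M * b ^+ 3 * M).
  apply: psd_comm_conj => //; first exact: psdX.
  by apply: commrX; exact: commr_sym.
have h2 : psd (M * N ^+ 3 * M).
  by apply: psd_comm_conj => //; apply: commrX; exact: commr_sym.
have e3 : M * N ^+ 3 = - (M * b ^+ 3).
  rewrite exprS mulrA MN mulNr -mulrA; congr (- (M * _)).
  by rewrite [RHS]exprS !expr2 -eb.
rewrite e3 mulNr in h2.
have z := psd_anti h1 h2.
suff M0 : M = 0 by rewrite -[N](subKr b) -/M M0 subr0.
have M6 : M ^+ 6 = 0.
  rewrite (exprM M 2 3) MM exprMn_n exprMn_comm // (exprS M) mulrA.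
  by rewrite -(commrX 3 (commr_sym bM) : _ = _) (exprS M 1) mulrA expr1 z mul0r mul0rn.
(* The exponent is raised to a power of two, which three uses of [sa_sqr0] bring down to 1. *)
have M8 : M ^+ 8 = 0 by rewrite -[8%N]/(6 + 2)%N exprD M6 mul0r.
apply: sa_sqr0 => //; apply: sa_sqr0; first by rewrite cstarM Ms.
apply: sa_sqr0; first by rewrite !cstarM Ms.
by rewrite -!expr2 -!exprM.
Qed.

Lemma nr_sa_pow2 (W : E) k : cstar W = W -> nr (W ^+ (2 ^ k)) = nr W ^+ (2 ^ k).
Proof.
move=> Ws; elim: k => [|k IH]; first by rewrite !expr1.
rewrite expnSr !exprM !expr2 nr_sqr_sa; last by rewrite cstarX Ws.
by rewrite IH expr2.
Qed.

(** If [N] is not zero, [W = N / t] with [t = nr N] is positive of norm 1, and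
    [(p + t/2) W = (t/2) (1 - W) W]. A left inverse of [p + t/2] thus bounds [W^m] by a multiple of
    [(1 - W) W^m], of order [1 / m], while [W^m] has norm 1 for [m] a power of two. *)
Lemma psd_of_spectrum p : cstar p = p ->
  (forall l : R, 0 < l -> exists y, y * (p + l :*: (1 : E)) = 1) -> psd p.
Proof.
move=> ps inv; have [N [q [Ns qs qN pE NN]]] := negative_part ps.
suff N0 : N = 0 by exists q; rewrite // pE N0 subr0.
apply/eqP/negP => /negP N0.
pose t := nr N.
have t0 : 0 < t.
  by rewrite lt_neqAle nr_ge0 andbT; apply: contra N0 => /eqP /esym /nr_eq0 ->.
(* [N] is twice the negative part, so [- t / 2] is the expected bottom of the spectrum of [p]. *)
have [y hy] := inv (t / 2) ltac:(lra).
pose W := t^-1 :*: N.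
have NW : N = t :*: W by rewrite rscaleA mulfV ?gt_eqF // rscale1.
have Ws : cstar W = W by rewrite cstarZR Ns.
have W1 : nr W = 1 by rewrite nrZR gtr0_norm ?invr_gt0 // mulVf // gt_eqF.
(* From [N N = 2 q q N] one gets [N^3 = 2 (q N)^2], and [psd_of_cube] then makes [N] itself
   positive. *)
have pN : psd (N ^+ 3).
  rewrite exprS expr2 NN mulrnAr -rscale_nat; apply: psdZ => //.
  exists (q * N); first by rewrite cstarM qs Ns qN.
  by rewrite -!mulrA [LHS]mulrA -qN -mulrA.
have pW : psd W by apply: psdZ; [rewrite invr_ge0 ltW | exact: psd_of_cube].
have pW2 : (p + (t / 2) :*: (1 : E)) * W = (t / 2) :*: ((1 - W) * W).
  have e : p * N = - (2^-1 :*: (N * N)).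
    rewrite {1}pE mulrBl {2}NN -rscale_nat rscaleA.
    rewrite (_ : 2^-1 * 2 = 1 :> R); last by field.
    by rewrite rscale1 NN mulr2n; abel.
  have e2 : p * W = - ((t / 2) :*: (W * W)).
    rewrite {1}/W rscaleMr e NW scalerN rscaleMl rscaleMr !rscaleA.
    by congr (- (_%:C *: _)); field; rewrite gt_eqF.
  by rewrite mulrDl e2 rscaleMl mul1r mulrBl mul1r scalerBr; abel.
have WX m : W ^+ m.+1 = (t / 2) :*: (y * ((1 - W) * W ^+ m.+1)).
  by rewrite -rscaleMr {2}exprS mulrA -rscaleMl -pW2 -!mulrA mulrA hy mul1r exprS.
pose c := t / 2 * nr y.
have c0 : 0 <= c by rewrite mulr_ge0 ?nr_ge0 // divr_ge0 // ltW.
have [k hk] : exists k, c < k%:R by exists (Num.bound c); exact: archi_boundP.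
have m0 : (0 < 2 ^ k)%N by rewrite expn_gt0.
have := nr_sa_pow2 k Ws; rewrite W1 expr1n -(prednK m0) WX prednK // nrZR gtr0_norm ?divr_gt0 //.
have := nr_feM y ((1 - W) * W ^+ (2 ^ k)).
have := nr_1B_powers (2 ^ k) pW; rewrite W1 => /(_ (lexx _)).
have l : k%:R <= (2 ^ k).+1%:R :> R by rewrite ler_nat ltnW // ltnS ltnW // ltn_expl.
set b := nr ((1 - W) * _); set a := nr (y * _) => h1 h2 h3.
have b0 : 0 <= b := nr_ge0 _.
have h4 : 1 <= c * b.
  have : t / 2 * a <= t / 2 * (nr y * b) by rewrite ler_pM2l // divr_gt0.
  by rewrite mulrA h3.
have bp : 0 < b by rewrite lt_neqAle b0 andbT eq_sym; apply/eqP => bz; move: h4; rewrite bz mulr0; lra.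
have h5 : c * b < (2 ^ k).+1%:R * b by rewrite ltr_pM2r // (lt_le_trans hk l).
by have := lt_le_trans h5 h1; rewrite ltNge h4.
Qed.

Lemma psd_gram g (b : fib B g) x : tin B x = tm (tst (tin B b)) (tin B b) -> psd x.
Proof.
move=> e; have [z [e1 [zs zi]]] := fpos b.
have xz : x = z by apply: fibI; rewrite e -e1.
apply: psd_of_spectrum; first by apply: fibI; rewrite cstarE xz.
move=> l l0; have [|y [_ hy]] := zi (- l)%:C.
  by rewrite lecE /= oppr_ge0 => /andP[_]; rewrite leNgt l0.
exists y; apply: fibI; rewrite femulE -hy xz; congr (tm _ (tin B _)).
by rewrite -scaleNr -rmorphN opprK.
Qed.

(** That a square has nonnegative spectrum is the bundle axiom [fpos] for [q], since
    [q q = q^* q]. *)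
Lemma psd_positive x : psd x <-> positive_e (@fmul G B) (@fstar G B) (funit B) x.
Proof.
split.
  move=> [q qs ->]; have [z [e zp]] := fpos (q : fib B gone).
  suff -> : q * q = z by [].
  by apply: fibI; rewrite -e femulE -{1}qs cstarE.
move=> [xs xi]; apply: psd_of_spectrum; first by apply: fibI; rewrite cstarE.
move=> l l0; have [|y [_ hy]] := xi (- l)%:C.
  by rewrite lecE /= oppr_ge0 => /andP[_]; rewrite leNgt l0.
exists y; apply: fibI; rewrite femulE -hy; congr (tm _ (tin B _)).
by rewrite -scaleNr -rmorphN opprK.
Qed.

(** For [x = q q] the conjugate is the Gram element of [q b], which [fpos] makes positive whatever
    the fibre of [b]. *)
Lemma psd_conj g (b : fib B g) x y :
  tin B y = tm (tst (tin B b)) (tm (tin B x) (tin B b)) -> psd x -> psd y.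
Proof.
move=> e [q qs xq].
apply: (@psd_gram _ (fmul B (q : fib B gone) b)); rewrite e.
rewrite -[tin B (fmul B _ _)]/(tm (tin B q) (tin B b)) tstM -cstarE qs xq femulE.
by rewrite !tmA.
Qed.

Lemma psd_closed x :
  (forall e : R, 0 < e -> exists2 y, psd y & nr (x - y) <= e) -> psd x.
Proof.
move=> h; have xs : cstar x = x.
  apply/eqP; rewrite -subr_eq0; apply/eqP/nr_eq0/eqP.
  rewrite eq_le nr_ge0 andbT; apply/ler_addgt0Pr => e e0; rewrite add0r.
  have [y py hy] := h (e / 2) ltac:(lra).
  have -> : cstar x - x = cstar (x - y) - (x - y) by rewrite cstarB (psd_sa py); abel.
  by apply: (le_trans (nrB _ _)); rewrite nr_cstar; lra.
(* The bound [nr x + 1] holds for every approximant within distance 1, so a single constant serves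
   for all [e]. *)
apply: (@psd_of_norm _ _ _ (nr x + 1)) => //.
apply/ler_addgt0Pr => e e0.
have [y py hy] := h (Num.min e 1) ltac:(by rewrite lt_min e0 ltr01).
move: hy; rewrite le_min => /andP[hy1 hy2].
have yx : nr y <= nr x + 1.
  have -> : y = x - (x - y) by abel.
  by apply: (le_trans (nrB _ _)); rewrite lerD2l.
set t := nr x + 1 in yx *.
have -> : t :*: (1 : E) - x = (t :*: (1 : E) - y) - (x - y) by abel.
by apply: (le_trans (nrB _ _)); apply: lerD => //; apply: psd_norm.
Qed.
End Negative.

(** * The graded *-algebra of a Fell bundle *)

Section Sections.
Variables (G : DGroup) (B : UFellBundle G).

(** Arbitrary families, without norm or summability: they serve only as a module on which all fibres
    act, so that elements of different fibres can be multiplied in one ring. *)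
Definition sect : Type := forall k : G, fib B k.
HB.instance Definition _ := gen_eqMixin sect.
HB.instance Definition _ := gen_choiceMixin sect.
Implicit Types v w : sect.

Lemma sectP v w : (forall k, v k = w k) -> v = w.
Proof. exact: functional_extensionality_dep. Qed.

Fact sectA : associative (fun v w : sect => (fun k => v k + w k) : sect).
Proof. by move=> u v w; apply: sectP => k; rewrite addrA. Qed.
Fact sectC : commutative (fun v w : sect => (fun k => v k + w k) : sect).
Proof. by move=> v w; apply: sectP => k; rewrite addrC. Qed.
Fact sect0 : left_id ((fun k => 0) : sect) (fun v w : sect => (fun k => v k + w k) : sect).
Proof. by move=> v; apply: sectP => k; rewrite add0r. Qed.
Fact sectN : left_inverse ((fun k => 0) : sect) (fun v : sect => (fun k => - v k) : sect)
  (fun v w : sect => (fun k => v k + w k) : sect).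
Proof. by move=> v; apply: sectP => k; rewrite addNr. Qed.
HB.instance Definition _ := GRing.isZmodule.Build sect sectA sectC sect0 sectN.

Definition sscale (c : C) v : sect := fun k => c *: v k.
Fact sscaleA a b v : sscale a (sscale b v) = sscale (a * b) v.
Proof. by apply: sectP => k; rewrite /sscale scalerA. Qed.
Fact sscale1 : left_id 1 sscale.
Proof. by move=> v; apply: sectP => k; rewrite /sscale scale1r. Qed.
Fact sscaleDr : right_distributive sscale +%R.
Proof. by move=> a v w; apply: sectP => k; rewrite /sscale scalerDr. Qed.
Fact sscaleDl v : {morph sscale^~ v : a b / a + b}.
Proof. by move=> a b; apply: sectP => k; rewrite /sscale scalerDl. Qed.
HB.instance Definition _ := GRing.Zmodule_isLmodule.Build C sect
  sscaleA sscale1 sscaleDr sscaleDl.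

Lemma sectDE v w k : (v + w) k = v k + w k. Proof. by []. Qed.
Lemma sectZE (c : C) v k : (c *: v) k = c *: v k. Proof. by []. Qed.
Definition lin_op (f : sect -> sect) := forall (c : C) v w, f (c *: v + w) = c *: f v + f w.

(* An adjointable pair: the action of an element together with that of its
   adjoint, so that composition and swapping give a *-algebra. *)
Record galg := Galg { gop : sect -> sect; gadj : sect -> sect;
  gop_lin : lin_op gop; gadj_lin : lin_op gadj }.
HB.instance Definition _ := gen_eqMixin galg.
HB.instance Definition _ := gen_choiceMixin galg.
Implicit Types x y z : galg.

Lemma galgP x y : gop x =1 gop y -> gadj x =1 gadj y -> x = y.
Proof.
case: x y => [a b al bl] [c d cl dl] /= /funext ac /funext bd.
rewrite -ac -bd in cl dl *.
by rewrite (Prop_irrelevance al cl) (Prop_irrelevance bl dl).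
Qed.

Lemma lin_op0 f : lin_op f -> f 0 = 0.
Proof.
move=> fl; have := fl 1 0 0; rewrite !scale1r addr0 => e.
by apply: (addrI (f 0)); rewrite -e addr0.
Qed.
Lemma lin_opD f v w : lin_op f -> f (v + w) = f v + f w.
Proof. by move=> fl; have := fl 1 v w; rewrite !scale1r. Qed.
Lemma lin_opZ f c v : lin_op f -> f (c *: v) = c *: f v.
Proof. by move=> fl; have := fl c v 0; rewrite (lin_op0 fl) !addr0. Qed.

Fact lin_opcD c f g : lin_op f -> lin_op g -> lin_op (fun v => c *: f v + g v).
Proof.
move=> fl gl a v w; rewrite fl gl !scalerDr !scalerA mulrC.
by rewrite addrACA.
Qed.
Fact lin_op_cst0 : lin_op (fun=> 0). Proof. by move=> c v w; rewrite scaler0 addr0. Qed.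
Fact lin_op_id : lin_op id. Proof. by []. Qed.
Fact lin_op_comp f g : lin_op f -> lin_op g -> lin_op (f \o g).
Proof. by move=> fl gl c v w; rewrite /= gl fl. Qed.

Definition gcomb c x y : galg :=
  Galg (lin_opcD c (@gop_lin x) (@gop_lin y)) (lin_opcD c^* (@gadj_lin x) (@gadj_lin y)).
Definition gzero : galg := Galg lin_op_cst0 lin_op_cst0.
Definition gunit : galg := Galg lin_op_id lin_op_id.
Definition gmul x y : galg :=
  Galg (lin_op_comp (@gop_lin x) (@gop_lin y)) (lin_op_comp (@gadj_lin y) (@gadj_lin x)).
Definition gstar x : galg := Galg (@gadj_lin x) (@gop_lin x).
Definition gadd x y := gcomb 1 x y.
Definition gopp x := gcomb (-1) x gzero.
Definition gscale c x := gcomb c x gzero.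

Fact gaddA : associative gadd.
Proof. by move=> x y z; apply: galgP => v /=; rewrite ?rmorph1 !scale1r addrA. Qed.
Fact gaddC : commutative gadd.
Proof. by move=> x y; apply: galgP => v /=; rewrite ?rmorph1 !scale1r addrC. Qed.
Fact gadd0 : left_id gzero gadd.
Proof. by move=> x; apply: galgP => v /=; rewrite ?rmorph1 !scale1r add0r. Qed.
Fact gaddN : left_inverse gzero gopp gadd.
Proof.
by move=> x; apply: galgP => v /=; rewrite ?rmorphN ?rmorph1 !scale1r scaleN1r addr0 addNr.
Qed.
HB.instance Definition _ := GRing.isZmodule.Build galg gaddA gaddC gadd0 gaddN.

Fact gmulA : associative gmul. Proof. by move=> x y z; apply: galgP. Qed.
Fact gmul1 : left_id gunit gmul. Proof. by move=> x; apply: galgP. Qed.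
Fact g1mul : right_id gunit gmul. Proof. by move=> x; apply: galgP. Qed.
Fact gmulDl : left_distributive gmul +%R.
Proof.
move=> x y z; apply: galgP => v //=.
by rewrite rmorph1 !scale1r lin_opD //; exact: gadj_lin.
Qed.
Fact gmulDr : right_distributive gmul +%R.
Proof.
move=> x y z; apply: galgP => v //=.
by rewrite !scale1r lin_opD //; exact: gop_lin.
Qed.
HB.instance Definition _ := GRing.Zmodule_isPzRing.Build galg
  gmulA gmul1 g1mul gmulDl gmulDr.

Fact gscaleA a b x : gscale a (gscale b x) = gscale (a * b) x.
Proof. by apply: galgP => v /=; rewrite ?rmorphM !addr0 scalerA. Qed.
Fact gscale1 : left_id 1 gscale.
Proof. by move=> x; apply: galgP => v /=; rewrite ?rmorph1 scale1r addr0. Qed.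
Fact gscaleDr : right_distributive gscale +%R.
Proof. by move=> a x y; apply: galgP => v /=; rewrite ?rmorph1 !addr0 !scale1r scalerDr. Qed.
Fact gscaleDl x : {morph gscale^~ x : a b / a + b}.
Proof. by move=> a b; apply: galgP => v /=; rewrite ?rmorph1 ?rmorphD !addr0 !scale1r scalerDl. Qed.
HB.instance Definition _ := GRing.Zmodule_isLmodule.Build C galg
  gscaleA gscale1 gscaleDr gscaleDl.

Lemma gZAl (c : C) x y : (c *: x) * y = c *: (x * y).
Proof.
apply: galgP => v //=; rewrite !addr0 lin_opZ //; exact: gadj_lin.
Qed.
Lemma gZAr (c : C) x y : x * (c *: y) = c *: (x * y).
Proof.
apply: galgP => v //=; rewrite !addr0 lin_opZ //; exact: gop_lin.
Qed.

Lemma gstarK x : gstar (gstar x) = x. Proof. exact: galgP. Qed.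
Lemma gstarM x y : gstar (x * y) = gstar y * gstar x. Proof. exact: galgP. Qed.
Lemma gstar1 : gstar 1 = 1. Proof. exact: galgP. Qed.
Lemma gstarD x y : gstar (x + y) = gstar x + gstar y.
Proof. by apply: galgP => v /=; rewrite ?rmorph1. Qed.
Lemma gstarZ (c : C) x : gstar (c *: x) = c^* *: gstar x.
Proof. by apply: galgP => v /=; rewrite ?conjCK. Qed.
Lemma gstar0 : gstar 0 = 0. Proof. exact: galgP. Qed.
Lemma gstarN x : gstar (- x) = - gstar x.
Proof. by rewrite -scaleN1r gstarZ rmorphN rmorph1 scaleN1r. Qed.
Lemma gstarB x y : gstar (x - y) = gstar x - gstar y.
Proof. by rewrite gstarD gstarN. Qed.
Lemma gstar_sum I (r : seq I) (F : I -> galg) :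
  gstar (\sum_(i <- r) F i) = \sum_(i <- r) gstar (F i).
Proof. exact: (big_morph _ gstarD gstar0). Qed.

Implicit Types s t : tot B.

(** Left convolution by the point mass [s]. *)
Definition lmulop s (w : sect) : sect :=
  fun k => trf (gmKV (tg s) k) (fmul B (projT2 s) (w (gm (ginv (tg s)) k))).

Lemma lmulopE s w k :
  tin B (lmulop s w k) = tm s (tin B (w (gm (ginv (tg s)) k))).
Proof. exact: trfE. Qed.

Lemma lmulop_lin s : lin_op (lmulop s).
Proof.
by move=> c v w; apply: sectP => k; rewrite sectDE sectZE /lmulop fmul_linr trfD.
Qed.

Definition emb s : galg := Galg (lmulop_lin s) (lmulop_lin (tst s)).

Lemma tin_sect (w : sect) (k l : G) : k = l -> tin B (w k) = tin B (w l).
Proof. by move=> ->. Qed.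

Lemma lmulopM s t w : lmulop (tm s t) w = lmulop s (lmulop t w).
Proof.
apply: sectP => k; apply: fibI; rewrite !lmulopE -tmA; congr (tm _ (tm _ _)).
by apply: tin_sect; rewrite /tg /= !grpE.
Qed.

Lemma lmulop1 w : lmulop (tot1 B) w = w.
Proof.
apply: sectP => k; apply: fibI; rewrite lmulopE tm1s.
by apply: tin_sect; rewrite /tg /= !grpE.
Qed.

Lemma embM s t : emb (tm s t) = emb s * emb t.
Proof. by apply: galgP => w /=; rewrite -lmulopM ?tstM. Qed.

Lemma emb1 : emb (tot1 B) = 1.
Proof. by apply: galgP => w /=; rewrite ?tst1 lmulop1. Qed.

Lemma emb_star s : emb (tst s) = gstar (emb s).
Proof. by apply: galgP => w /=; rewrite ?tstK. Qed.

Lemma lmulop_comb g (c : C) (a b : fib B g) w :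
  lmulop (tin B (c *: a + b)) w = c *: lmulop (tin B a) w + lmulop (tin B b) w.
Proof.
by apply: sectP => k; rewrite sectDE sectZE /lmulop fmul_linl trfD.
Qed.

Lemma emb_comb g (c : C) (a b : fib B g) :
  emb (tin B (c *: a + b)) = c *: emb (tin B a) + emb (tin B b).
Proof.
apply: galgP => w /=; rewrite addr0 ?rmorph1 !scale1r; first exact: lmulop_comb.
by rewrite /tst /= fstar_conjlin lmulop_comb.
Qed.

Lemma embD g (a b : fib B g) : emb (tin B (a + b)) = emb (tin B a) + emb (tin B b).
Proof. by rewrite -[a in LHS]scale1r emb_comb scale1r. Qed.
Lemma emb0 g : emb (tin B (0 : fib B g)) = 0.
Proof.
by apply: (addrI (emb (tin B (0 : fib B g)))); rewrite -embD !addr0.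
Qed.
Lemma embZ g (c : C) (a : fib B g) : emb (tin B (c *: a)) = c *: emb (tin B a).
Proof. by rewrite -[c *: a]addr0 emb_comb emb0 addr0. Qed.
Lemma embN g (a : fib B g) : emb (tin B (- a)) = - emb (tin B a).
Proof. by rewrite -scaleN1r embZ scaleN1r. Qed.
Lemma embB g (a b : fib B g) : emb (tin B (a - b)) = emb (tin B a) - emb (tin B b).
Proof. by rewrite embD embN. Qed.

(** * Homogeneous elements: coefficients, norm and positivity *)

Definition unit_sect : sect := fun k =>
  if pselect (gone = k) is left e then trf e (funit B) else 0.

Lemma unit_sect1 : tin B (unit_sect gone) = tot1 B.
Proof. by rewrite /unit_sect; case: pselect => // e; rewrite trfE. Qed.

(** Applying the operator to the unit section recovers the element of the fibre, which is why [emb]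
    is injective on each fibre. *)
Definition coef (g : G) x : fib B g := gop x unit_sect g.

Lemma coef0 g : coef g 0 = 0. Proof. by []. Qed.
Lemma coef_emb g (b : fib B g) : coef g (emb (tin B b)) = b.
Proof.
apply: fibI; rewrite /coef /= lmulopE.
have -> : tin B (unit_sect (gm (ginv (tg (tin B b))) g)) = tot1 B.
  by rewrite -unit_sect1; apply: tin_sect; rewrite /tg /= gmVx.
exact: tms1.
Qed.

Lemma coef_emb_ne g h (b : fib B g) : g <> h -> coef h (emb (tin B b)) = 0.
Proof.
move=> gh; rewrite /coef /= /lmulop (_ : unit_sect _ = 0) ?fmul0r.
  by apply: nr_eq0; rewrite nr_trf nr0.
rewrite /unit_sect; case: pselect => // e; case: gh.
by rewrite -[LHS]gmx1 e gmKV.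
Qed.

(** As a predicate, homogeneity asks degrees only to be provably equal, as in [degM'], and no
    transport between fibres occurs. *)
Definition deg (g : G) x := exists b : fib B g, x = emb (tin B b).

Lemma deg_tin g (b : fib B g) : deg g (emb (tin B b)).
Proof. by exists b. Qed.
Lemma emb_coef g x : deg g x -> emb (tin B (coef g x)) = x.
Proof. by move=> [b ->]; rewrite coef_emb. Qed.
Lemma deg0 g : deg g 0. Proof. by exists 0; rewrite emb0. Qed.
Lemma deg1 : deg gone 1. Proof. by rewrite -emb1; exact: (deg_tin (funit B)). Qed.
Lemma degD g x y : deg g x -> deg g y -> deg g (x + y).
Proof. by move=> [a ->] [b ->]; exists (a + b); rewrite embD. Qed.
Lemma degZ g (c : C) x : deg g x -> deg g (c *: x).
Proof. by move=> [a ->]; exists (c *: a); rewrite embZ. Qed.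
Lemma degN g x : deg g x -> deg g (- x).
Proof. by move=> h; rewrite -scaleN1r; exact: degZ. Qed.
Lemma degB g x y : deg g x -> deg g y -> deg g (x - y).
Proof. by move=> h h'; apply: degD => //; exact: degN. Qed.
Lemma degM g h x y : deg g x -> deg h y -> deg (gm g h) (x * y).
Proof. by move=> [a ->] [b ->]; rewrite -embM; exact: (deg_tin (fmul B a b)). Qed.
Lemma degM' g h k x y : deg g x -> deg h y -> k = gm g h -> deg k (x * y).
Proof. by move=> hx hy ->; exact: degM. Qed.
Lemma deg_star g x : deg g x -> deg (ginv g) (gstar x).
Proof. by move=> [a ->]; rewrite -emb_star; exact: (deg_tin (fstar B a)). Qed.
(** The norm of a homogeneous element, with the default 0 on the others. The choice of the degree
    does not matter: distinct fibres meet only in 0, which is homogeneous of every degree. *)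
Definition nb x : R := if pselect (exists g, deg g x) is left e
  then nr (coef (projT1 (cid e)) x) else 0.

Lemma nbE g x : deg g x -> nb x = nr (coef g x).
Proof.
move=> dx; rewrite /nb; case: pselect => [e|]; last by case; exists g.
case: (cid e) => /= h [b xb]; have [<-//|hg] := pselect (g = h).
move: dx => [a xa]; rewrite {1}xa coef_emb_ne // xb coef_emb_ne ?nr0 //.
by move=> /esym.
Qed.

Lemma nb_emb g (b : fib B g) : nb (emb (tin B b)) = nr b.
Proof. by rewrite (nbE (deg_tin b)) coef_emb. Qed.

Lemma nb_ge0 x : 0 <= nb x.
Proof. by rewrite /nb; case: pselect => // e; exact: nr_ge0. Qed.
Lemma nb0 : nb 0 = 0.
Proof. by rewrite (nbE (deg0 gone)) coef0 nr0. Qed.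
Lemma nb_eq0 g x : deg g x -> nb x = 0 -> x = 0.
Proof. by move=> [b ->]; rewrite nb_emb => /nr_eq0 ->; exact: emb0. Qed.
Lemma nbD g x y : deg g x -> deg g y -> nb (x + y) <= nb x + nb y.
Proof. by move=> [a ->] [b ->]; rewrite -embD !nb_emb nrD. Qed.
Lemma nbB g x y : deg g x -> deg g y -> nb (x - y) <= nb x + nb y.
Proof. by move=> [a ->] [b ->]; rewrite -embB !nb_emb nrB. Qed.
Lemma nbZ g (c : C) x : deg g x -> nb (c *: x) = complex.Re `|c| * nb x.
Proof. by move=> [a ->]; rewrite -embZ !nb_emb nrZ. Qed.
Lemma nbZR g (r : R) x : deg g x -> nb (r :*: x) = `|r| * nb x.
Proof. by move=> [a ->]; rewrite -embZ !nb_emb nrZR. Qed.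
Lemma nbN g x : deg g x -> nb (- x) = nb x.
Proof. by move=> [a ->]; rewrite -embN !nb_emb nrN. Qed.
Lemma nbM g h x y : deg g x -> deg h y -> nb (x * y) <= nb x * nb y.
Proof.
by move=> [a ->] [b ->]; rewrite -embM (nb_emb (fmul B a b)) !nb_emb nr_fmul.
Qed.
Lemma nb_star g x : deg g x -> nb (gstar x) = nb x.
Proof.
by move=> [a ->]; rewrite -emb_star (nb_emb (fstar B a)) nb_emb nr_fstar.
Qed.
Lemma nb_Cstar g x : deg g x -> nb (gstar x * x) = nb x ^+ 2.
Proof.
move=> [a ->]; rewrite -emb_star -embM.
by rewrite (nb_emb (fmul B (fstar B a) a)) nb_emb nr_Cstar.
Qed.

Local Notation E := (fe B).
Definition io (x : E) : galg := emb (tin B x).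
Lemma ioM (x y : E) : io (x * y) = io x * io y.
Proof. by rewrite /io femulE embM. Qed.
Lemma io_star (x : E) : io (cstar x) = gstar (io x).
Proof. by rewrite /io cstarE emb_star. Qed.
Lemma io_inj (x y : E) : io x = io y -> x = y.
Proof. by move=> e; rewrite -(coef_emb x) -(coef_emb y) -[emb _]/(io x) e. Qed.

Definition pos x := exists2 p : E, psd p & x = io p.

Lemma pos_deg x : pos x -> deg gone x.
Proof. by move=> [p _ ->]; exact: deg_tin. Qed.
Lemma pos0 : pos 0.
Proof. by exists 0; [exact: psd0 | rewrite /io emb0]. Qed.
Lemma pos1 : pos 1.
Proof. by exists 1; [exact: psd1 | rewrite -emb1]. Qed.
Lemma posD x y : pos x -> pos y -> pos (x + y).
Proof. by move=> [p pp ->] [q pq ->]; exists (p + q); [exact: psdD | rewrite /io embD]. Qed.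
Lemma posZ (r : R) x : 0 <= r -> pos x -> pos (r :*: x).
Proof. by move=> r0 [p pp ->]; exists (r :*: p); [exact: psdZ | rewrite /io embZ]. Qed.
Lemma pos_star x : pos x -> gstar x = x.
Proof. by move=> [p pp ->]; rewrite -io_star psd_sa. Qed.
Lemma pos_conj g x c : deg g c -> pos x -> pos (gstar c * x * c).
Proof.
move=> [b ->] [p pp ->]; rewrite -emb_star -!embM.
have e : gm (gm (ginv g) gone) g = gone by rewrite !grpE.
exists (trf e (fmul B (fmul B (fstar B b) p) b)); last by rewrite /io trfE.
by apply: psd_conj pp; rewrite trfE tmA.
Qed.
Lemma pos_gram g c : deg g c -> pos (gstar c * c).
Proof. by move=> dc; rewrite -[gstar c]mulr1; apply: pos_conj dc pos1. Qed.
Lemma pos_closed x : deg gone x ->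
  (forall e : R, 0 < e -> exists2 y, pos y & nb (x - y) <= e) -> pos x.
Proof.
move=> [b ->] h; exists b => //; apply: psd_closed => e e0.
have [y [p pp ->] hy] := h e e0; exists p => //.
by move: hy; rewrite -embB nb_emb.
Qed.
Lemma pos_le_nb x (t : R) : deg gone x -> gstar x = x -> nb x <= t -> pos (t :*: (1 : galg) - x).
Proof.
move=> [b ->] bs; rewrite nb_emb => bt; exists (t :*: (1 : E) - (b : E)).
  by apply: psd_le_nr bt; apply: io_inj; rewrite io_star.
by rewrite /io embB embZ -emb1.
Qed.
Lemma pos_nb_mono x y : pos x -> pos (y - x) -> nb x <= nb y.
Proof.
move=> [p pp ->] [q pq e].
have -> : y = io (p + q) by rewrite /io embD -[emb (tin B q)]/(io q) -[emb (tin B p)]/(io p) -e; abel.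
rewrite !nb_emb; apply: psd_nr_mono => //.
by rewrite (_ : p + q - p = q) //; abel.
Qed.
Lemma pos_anti x : pos x -> pos (- x) -> x = 0.
Proof.
move=> [p pp ->] [q pq e]; have -> : p = 0; last by rewrite /io emb0.
apply: psd_anti => //; suff -> : - p = q by [].
by apply: io_inj; rewrite -e /io embN.
Qed.
Lemma pos_positive x : pos x <-> Bpos (tin B (coef gone x)) /\ deg gone x.
Proof.
split.
  move=> [p pp ->]; split; last exact: deg_tin.
  exists p; split; first by rewrite coef_emb.
  exact/psd_positive.
move=> [[p [e pp]] dx]; exists p; first exact/psd_positive.
by rewrite -(emb_coef dx) e.
Qed.

Lemma gnegative_part x : deg gone x -> gstar x = x ->
  exists N q, [/\ deg gone N, deg gone q, gstar N = N & gstar q = q] /\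
    [/\ q * N = N * q, x = q * q - N & N * N = (q * q * N) *+ 2].
Proof.
move=> [b ->] bs; have [|N [q [Ns qs qN e NN]]] := @negative_part _ _ (b : E).
  by apply: io_inj; rewrite io_star.
exists (io N), (io q); do !split; rewrite -?io_star -?ioM ?Ns ?qs ?qN //; try exact: deg_tin.
  by rewrite {1}e embB.
by rewrite NN !mulr2n {1}/io embD.
Qed.
End Sections.
Arguments coef : simpl never.
Arguments emb : simpl never.

(** * Positivity of the kernel *)

Section Kernel.
Variables (G H : DGroup) (A : UFellBundle G) (B : UFellBundle H).
Variables (phi : G -> H) (T : forall g : G, fib A g -> fib B (phi g)).
Hypotheses (phiM : is_hom phi) (Tb : is_bundle_map T) (Tp : pos_def T).
Local Notation alg := (galg B).
Implicit Types (s t u : tot A) (b d : alg) (f : tot A -> alg).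
Implicit Types (y z : seq (tot A * alg)) (h k : H).

Definition TT s : alg := emb (tin B (T (projT2 s))).

Lemma deg_Tt s : deg (phi (tg s)) (TT s).
Proof. exact: deg_tin. Qed.

Lemma Tt_lin g (c : C) (a a' : fib A g) :
  TT (tin A (c *: a + a')) = c *: TT (tin A a) + TT (tin A a').
Proof. by rewrite /TT /= (Tb g).1 emb_comb. Qed.

Lemma Tt_bnd g : exists2 K : R, 0 <= K & forall a : fib A g, nb (TT (tin A a)) <= K * nr a.
Proof.
(* The constant [M] is complex, and only a nonzero [a] forces it to be real and nonnegative; hence
   the absolute value of its real part and the separate case [nr a = 0]. *)
have [M hM] := (Tb g).2; exists (`|complex.Re M|) => // a.
rewrite nb_emb nr_le (le_trans (hM a)) //= nrE rmorphM /=.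
have [-> | a0] := eqVneq (nr a) 0; first by rewrite !mulr0.
have ap : 0 < nr a by rewrite lt_neqAle eq_sym a0 nr_ge0.
rewrite ler_pM2r ?ltcR //.
have := hM a; rewrite nrE => hM'.
have : (0 : C) <= M * `|a| by apply: le_trans hM'; rewrite lecR nr_ge0.
rewrite nrE pmulr_lge0 ?ltcR // => M0.
case: M M0 {hM hM'} => m n; rewrite !lecE /= => /andP[/eqP -> m0].
by rewrite eqxx ler_norm.
Qed.

(* An element [sum s (x) b] of the algebraic module is represented by a list of
   pairs; it has degree [h] when every [b] lies in the fibre at [phi(s)^-1 h]. *)
Fixpoint inmod h y : Prop :=
  if y is p :: y' then deg (gm (ginv (phi (tg p.1))) h) p.2 /\ inmod h y' else True.

Definition pairing y f : alg := \sum_(p <- y) gstar p.2 * f p.1.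
Definition kern y s : alg := \sum_(p <- y) TT (tm (tst s) p.1) * p.2.
Definition ip y z := pairing y (kern z).
Definition lact s y := [seq (tm s p.1, p.2) | p <- y].
Definition rmul y b := [seq (p.1, p.2 * b) | p <- y].

Definition graded h f := forall s, deg (gm (ginv (phi (tg s))) h) (f s).

Lemma pairing_cons p y f : pairing (p :: y) f = gstar p.2 * f p.1 + pairing y f.
Proof. by rewrite /pairing big_cons. Qed.
Lemma pairing_nil f : pairing [::] f = 0.
Proof. by rewrite /pairing big_nil. Qed.
Lemma pairing_cat y z f : pairing (y ++ z) f = pairing y f + pairing z f.
Proof. by rewrite /pairing big_cat. Qed.
Lemma pairing_comb y (c : C) f f' :
  pairing y (fun s => c *: f s + f' s) = c *: pairing y f + pairing y f'.
Proof.
rewrite /pairing scaler_sumr -big_split; apply: eq_bigr => p _.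
by rewrite mulrDr gZAr.
Qed.
Lemma pairingD y f f' : pairing y (fun s => f s + f' s) = pairing y f + pairing y f'.
Proof. by rewrite /pairing -big_split; apply: eq_bigr => p _; rewrite mulrDr. Qed.
Lemma eq_pairing y f f' : f =1 f' -> pairing y f = pairing y f'.
Proof. by move=> e; apply: eq_bigr => p _; rewrite e. Qed.
Lemma pairing_mulr y f b : pairing y (fun s => f s * b) = pairing y f * b.
Proof. by rewrite /pairing mulr_suml; apply: eq_bigr => p _; rewrite mulrA. Qed.
Lemma pairing_rmul y f b : pairing (rmul y b) f = gstar b * pairing y f.
Proof.
by rewrite /pairing big_map mulr_sumr; apply: eq_bigr => p _; rewrite gstarM mulrA.
Qed.
Lemma pairing_act s y f : pairing (lact s y) f = pairing y (f \o tm s).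
Proof. by rewrite /pairing big_map. Qed.

Lemma kern_cons p y s : kern (p :: y) s = TT (tm (tst s) p.1) * p.2 + kern y s.
Proof. by rewrite /kern big_cons. Qed.
Lemma kern_cat y z s : kern (y ++ z) s = kern y s + kern z s.
Proof. by rewrite /kern big_cat. Qed.
Lemma kern_rmul y b s : kern (rmul y b) s = kern y s * b.
Proof. by rewrite /kern big_map mulr_suml; apply: eq_bigr => p _; rewrite mulrA. Qed.
Lemma kern_act t y s : kern (lact t y) s = kern y (tm (tst t) s).
Proof. by rewrite /kern big_map; apply: eq_bigr => p _ /=; rewrite tstM tstK tmA. Qed.

Lemma ip_catl y y' z : ip (y ++ y') z = ip y z + ip y' z.
Proof. exact: pairing_cat. Qed.
Lemma ip_catr y z z' : ip y (z ++ z') = ip y z + ip y z'.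
Proof. by rewrite /ip -pairingD; apply: eq_pairing => s; rewrite kern_cat. Qed.
Lemma ip_rmull y z b : ip (rmul y b) z = gstar b * ip y z.
Proof. exact: pairing_rmul. Qed.
Lemma ip_rmulr y z b : ip y (rmul z b) = ip y z * b.
Proof. by rewrite /ip -pairing_mulr; apply: eq_pairing => s; rewrite kern_rmul. Qed.
Lemma inmod_cat h y z : inmod h y -> inmod h z -> inmod h (y ++ z).
Proof. by elim: y => //= p y IH [hp hy] hz; split => //; exact: IH. Qed.
Lemma inmod_rmul h k y b : deg k b -> inmod h y -> inmod (gm h k) (rmul y b).
Proof.
move=> db; elim: y => //= p y IH [hp hy]; split; last exact: IH.
by apply: degM' hp db _; rewrite gmA.
Qed.
Lemma inmod_act h s y : inmod h y -> inmod (gm (phi (tg s)) h) (lact s y).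
Proof.
elim: y => //= p y IH [hp hy]; split; last exact: IH.
by move: hp; rewrite /tg /= phiM !grpE.
Qed.

Lemma graded_kern h y : inmod h y -> graded h (kern y).
Proof.
move=> hy s; elim: y hy => [_|p y IH /= [hp hy]].
  by rewrite /kern big_nil; exact: deg0.
rewrite kern_cons; apply: degD; last exact: IH.
by apply: degM' (deg_Tt _) hp _; rewrite /tg /= !(homE phiM) !grpE.
Qed.
Lemma deg_pairing h k y f : inmod h y -> graded k f -> deg (gm (ginv h) k) (pairing y f).
Proof.
move=> hy gf; elim: y hy => [_|p y IH /= [hp hy]].
  by rewrite pairing_nil; exact: deg0.
rewrite pairing_cons; apply: degD; last exact: IH.
by apply: degM' (deg_star hp) (gf _) _; rewrite !grpE.
Qed.
Lemma deg_ip h k y z : inmod h y -> inmod k z -> deg (gm (ginv h) k) (ip y z).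
Proof. by move=> hy hz; apply: deg_pairing => //; exact: graded_kern. Qed.

Lemma tin_coef (s : tot B) h : tg s = h -> tin B (coef h (emb s)) = s.
Proof. by case: s => g a; rewrite /tg /= => <-; rewrite coef_emb. Qed.

(** In degree [gone] the adjoint of the coefficient of [s] lies over [phi (tg s)], so positive
    definiteness applies with the adjoints as its [b i]. *)
Lemma pos_ip_one y : inmod gone y -> pos (ip y y).
Proof.
move=> hy; pose p0 : tot A * alg := (tot1 A, 0).
pose p (i : 'I_(size y)) := nth p0 y i.
have hp i : deg (gm (ginv (phi (tg (p i).1))) gone) (p i).2.
  rewrite /p; case: i => i /=; elim: y i hy {p} => //= r y IH [|i] [hr hy] //.
  exact: IH.
have hp' i : emb (tin B (coef (phi (tg (p i).1)) (gstar (p i).2))) = gstar (p i).2.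
  by apply: emb_coef; have := deg_star (hp i); rewrite !grpE.
pose term i j := tm (tm (tin B (coef (phi (tg (p i).1)) (gstar (p i).2)))
   (tin B (T (projT2 (tm (tst (p i).1) (p j).1)))))
   (tst (tin B (coef (phi (tg (p j).1)) (gstar (p j).2)))).
have te i j : emb (term i j) = gstar (p i).2 * (TT (tm (tst (p i).1) (p j).1) * (p j).2).
  by rewrite !embM emb_star !hp' gstarK mulrA.
have h := Tp (g := fun i => tg (p i).1) (a := fun i => projT2 (p i).1)
  (b := fun i => coef (phi (tg (p i).1)) (gstar (p i).2))
  (c := fun i j => coef gone (emb (term i j))).
have {}h := h (fun i j => esym (tin_coef _)).
have := (psd_positive _).2 (h _); set x := \sum_(i < _) _ => px.
exists x; first by apply: px => i j; rewrite /term /tg /= !(homE phiM) !grpE.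
rewrite /ip /pairing (big_nth p0) big_mkord /x.
pose toA : fe B -> alg := @io _ B.
have ioD a a' : toA (a + a') = toA a + toA a' by exact: embD.
have io0 : toA 0 = 0 by exact: emb0.
rewrite -/(toA _) (big_morph _ ioD io0); apply: eq_bigr => i _.
rewrite (big_morph _ ioD io0) /kern (big_nth p0) big_mkord mulr_sumr.
apply: eq_bigr => j _; rewrite -te /toA /io tin_coef //.
by rewrite /term /tg /= !(homE phiM) !grpE.
Qed.

Lemma ip_unfold y z : ip y z = \sum_(p <- y) \sum_(q <- z) gstar p.2 * TT (tm (tst p.1) q.1) * q.2.
Proof.
rewrite /ip /pairing; apply: eq_bigr => p _; rewrite /kern mulr_sumr.
by apply: eq_bigr => q _; rewrite mulrA.
Qed.

(* Self-adjointness of [T s b + b^* T s^*] after rotating [b] by all scalars. *)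
Lemma Tt_star s : gstar (TT s) = TT (tst s).
Proof.
pose d := TT (tst s) - gstar (TT s).
have dd : deg (ginv (phi (tg s))) d.
  apply: degB; last exact: deg_star (deg_Tt _).
  by rewrite -(homV phiM); exact: (deg_Tt (tst s)).
(* With [b := d] this reads [gstar d * d = 0], so [d = 0]. *)
suff bd b : deg (ginv (phi (tg s))) b -> gstar b * d = 0.
  have := nb_Cstar dd; rewrite (bd _ dd) nb0 => /esym/eqP; rewrite sqrf_eq0 => /eqP.
  by move=> /(nb_eq0 dd)/eqP; rewrite subr_eq0 => /eqP.
move=> db; pose X := TT s * b; pose Y := gstar b * TT (tst s).
have sa y : inmod gone y -> gstar (ip y y) = ip y y by move=> /pos_ip_one/pos_star.
(* In the inner square of [1 (x) c + s (x) b] the diagonal terms are self-adjoint, hence so is the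
   sum of the cross terms. *)
have key (c : C) : gstar (c^* *: X + c *: Y) = c^* *: X + c *: Y.
  have i1 : inmod gone [:: (tot1 A, c *: (1 : alg))].
    by split=> //; rewrite (homE phiM) ginv1 gm1x; apply: degZ; exact: deg1.
  have i2 : inmod gone [:: (s, b)] by split => //; rewrite gmx1.
  have i3 : inmod gone ([:: (tot1 A, c *: (1 : alg))] ++ [:: (s, b)]) by apply: inmod_cat.
  have e1 : ip [:: (tot1 A, c *: (1 : alg))] [:: (s, b)] = c^* *: X.
    by rewrite ip_unfold !big_seq1 /= gstarZ gstar1 tst1 tm1s gZAl mul1r gZAl.
  have e2 : ip [:: (s, b)] [:: (tot1 A, c *: (1 : alg))] = c *: Y.
    by rewrite ip_unfold !big_seq1 /= tms1 gZAr mulr1.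
  have := sa _ i3; rewrite !ip_catl !ip_catr e1 e2 !gstarD (sa _ i1) (sa _ i2).
  by rewrite -!addrA => /addrI; rewrite !addrA => /addIr.
have [i ci ii] : exists2 i : C, Num.conj i = - i & i * i = -1.
  exists 'i%C; last by rewrite -expr2 sqr_i.
  by apply/eqP; rewrite eq_complex /= oppr0 !eqxx.
have k1 := key 1; have ki := key i.
rewrite rmorph1 !scale1r gstarD in k1.
have {}ki : gstar X - gstar Y = Y - X.
  have := congr1 (fun x => (- i) *: x) ki; rewrite gstarD !gstarZ conjCK !ci !scalerDr !scalerA.
  by rewrite !mulrNN !mulNr ?mulrN ii !opprK !scaleNr !scale1r => ->; abel.
have XY : gstar X + gstar X = Y + Y.
  have -> : gstar X + gstar X = (gstar X + gstar Y) + (gstar X - gstar Y) by abel.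
  by rewrite k1 ki; abel.
have {}XY : gstar X = Y.
  have := congr1 (fun x : alg => 2^-1 :*: x) XY.
  by rewrite !scalerDr -!rscaleDl (_ : 2^-1 + 2^-1 = 1 :> R) ?rscale1 //; field.
by rewrite /d mulrBr -gstarM -/X XY subrr.
Qed.

Lemma ip_star y z : gstar (ip y z) = ip z y.
Proof.
rewrite !ip_unfold gstar_sum exchange_big; apply: eq_bigr => p _ /=.
rewrite gstar_sum; apply: eq_bigr => q _.
by rewrite !gstarM gstarK Tt_star tstM tstK mulrA.
Qed.

Lemma gram0 k b : deg k b -> gstar b * b = 0 -> b = 0.
Proof.
move=> db e; apply: (nb_eq0 db); apply/eqP.
by rewrite -sqrf_eq0 -(nb_Cstar db) e nb0.
Qed.

(* [D = <y,y>] satisfies [d D d^* >= 0] for all [d] of degree [h].  Writing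
   [D = |D| - N] and taking [d = b0 N] gives [b0 N = 0], so that
   [N D N = N <y',y'> N >= 0], which forces [N = 0]. *)
Lemma pos_ip_cons h (s0 : tot A) b0 y :
  tg s0 = gone -> inmod h ((s0, b0) :: y) -> pos (ip y y) ->
  pos (ip ((s0, b0) :: y) ((s0, b0) :: y)).
Proof.
move=> s0e hy py; set z := _ :: _ in hy *; set D := ip z z.
have db0 : deg h b0 by case: hy => /= [+ _]; rewrite s0e (homE phiM) ginv1 gm1x.
have dD : deg gone D by have := deg_ip hy hy; rewrite gmVx.
have [N [q [[dN dq Ns qs] [qN DE NN]]]] := gnegative_part dD (ip_star z z).
(* [N D N = N q q N - N N N], and [N N N = 2 N q q N]. *)
have NDN : N * D * N = - (gstar (q * N) * (q * N)).
  rewrite gstarM Ns qs DE mulrBr mulrBl -[N * N * N]mulrA NN mulr2n mulrDr opprD.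
  have e : N * (q * q * N) = N * q * (q * N) by rewrite !mulrA.
  by rewrite e !mulrA; abel.
have qN0 c : q * N * c = 0 -> N * N * c = 0.
  by move=> e; rewrite NN mulr2n mulrDl -(mulrA q q) -(mulrA q) e mulr0 addr0.
have dqN : deg gone (q * N) by apply: degM' dq dN _; rewrite gm1x.
have b0N : b0 * N = 0.
  (* Multiplying [z] by the adjoint of [b0 N], of degree [ginv h], leads to degree [gone], where
     positivity is known. *)
  have pd : pos (b0 * N * D * gstar (b0 * N)).
    have -> : b0 * N * D * gstar (b0 * N) = ip (rmul z (gstar (b0 * N))) (rmul z (gstar (b0 * N))).
      by rewrite ip_rmull ip_rmulr gstarK !mulrA.
    apply: pos_ip_one; rewrite -(gmxV h); apply: inmod_rmul hy.
    apply: deg_star; apply: degM' db0 dN _; by rewrite gmx1.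
  (* [pd] says that [- gstar x * x] is positive, so [x = 0]; as [N N = 2 q q N], this kills
     [N N (gstar b0)] and hence [N (gstar b0)]. *)
  set x := q * N * gstar b0.
  have dx : deg (ginv h) x by apply: degM' dqN (deg_star db0) _; rewrite gm1x.
  have x0 : x = 0.
    apply: (gram0 dx); apply: pos_anti; first exact: pos_gram dx.
    move: pd; congr (pos _); rewrite gstarM Ns.
    rewrite (_ : _ * _ = b0 * (N * D * N) * gstar b0); last by rewrite !mulrA.
    by rewrite NDN mulrN mulNr /x [gstar (q * N * _)]gstarM gstarK !mulrA.
  have Nb : N * gstar b0 = 0.
    have d1 : deg (ginv h) (N * gstar b0).
      by apply: degM' dN (deg_star db0) _; rewrite gm1x.
    apply: (gram0 d1).
    by rewrite gstarM gstarK Ns -mulrA (mulrA N) qN0 ?mulr0.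
  by rewrite -[b0 * N]gstarK gstarM Ns Nb gstar0.
have pNDN : pos (N * D * N).
  have -> : N * D * N = gstar N * ip y y * N.
    rewrite {1}Ns.
    have -> : N * D * N = ip (rmul z N) (rmul z N) by rewrite ip_rmull ip_rmulr Ns !mulrA.
    have -> : N * ip y y * N = ip (rmul y N) (rmul y N) by rewrite ip_rmull ip_rmulr Ns !mulrA.
    rewrite /z /= b0N !ip_unfold big_cons /= big1 ?add0r; last first.
      by move=> p _; rewrite gstar0 !mul0r.
    by apply: eq_bigr => p _; rewrite big_cons /= mulr0 add0r.
  exact: pos_conj dN py.
have N0 : q * N = 0.
  apply: (gram0 dqN); apply: pos_anti; first exact: pos_gram dqN.
  by rewrite -NDN.
have {}N0 : N = 0.
  apply: (gram0 dN); rewrite Ns -[N * N]mulr1 qN0 // mulr1 //.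
by rewrite DE N0 subr0 -{1}qs; exact: pos_gram dq.
Qed.

(** * Reduction to a first entry of degree [e] *)

Lemma nrT_ge0 (s : tot A) : 0 <= nrT s. Proof. exact: nr_ge0. Qed.
Lemma nrTM (s t : tot A) : nrT (tm s t) <= nrT s * nrT t.
Proof. exact: nr_fmul. Qed.
Lemma nrT_star (s : tot A) : nrT (tst s) = nrT s.
Proof. exact: nr_fstar. Qed.
Lemma nrT_Cstar (s : tot A) : nrT (tm s (tst s)) = nrT s ^+ 2.
Proof. by rewrite /nrT /= nr_Cstar' nr_fstar. Qed.

Lemma Tt_bndT g : exists2 K : R, 0 <= K & forall s, tg s = g -> nb (TT s) <= K * nrT s.
Proof. by have [K K0 h] := Tt_bnd g; exists K => // -[g' a]; rewrite /tg /= => e; subst g'; apply: h. Qed.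

Local Notation EA := (fe A).

(** The inner product with [m] inserted between the two arguments. It is linear in [m] from the unit
    fibre, so an identity there, such as [q q + p0 = 1], splits the inner product. *)
Definition mform (m : tot A) y z : alg :=
  \sum_(p <- y) \sum_(q <- z) gstar p.2 * TT (tm (tst p.1) (tm m q.1)) * q.2.

Lemma form_act s y z : ip (lact s y) (lact s z) = mform (tm (tst s) s) y z.
Proof.
rewrite ip_unfold /mform big_map; apply: eq_bigr => p _.
by rewrite big_map; apply: eq_bigr => q _ /=; rewrite tstM !tmA.
Qed.

Lemma form1 y z : mform (tot1 A) y z = ip y z.
Proof.
rewrite ip_unfold /mform; apply: eq_bigr => p _.
by apply: eq_bigr => q _ /=; rewrite tm1s.
Qed.

Lemma Tt_mid (u v : tot A) (x x' : EA) :
  TT (tm u (tm (tin A (x + x')) v)) = TT (tm u (tm (tin A x) v)) + TT (tm u (tm (tin A x') v)).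
Proof.
have e : tm u (tm (tin A (x + x')) v) =
    tin A (1 *: (fmul A (projT2 u) (fmul A (x : fib A gone) (projT2 v))) +
      (fmul A (projT2 u) (fmul A (x' : fib A gone) (projT2 v)))).
  rewrite -fmul_linr; congr (tin A (fmul A _ _)).
  by rewrite scale1r -[in RHS](scale1r (fmul A x _)) -fmul_linl scale1r.
by rewrite e Tt_lin scale1r.
Qed.

Lemma formD (x x' : EA) y z :
  mform (tin A (x + x')) y z = mform (tin A x) y z + mform (tin A x') y z.
Proof.
rewrite /mform -big_split; apply: eq_bigr => p _; rewrite -big_split.
by apply: eq_bigr => q _ /=; rewrite Tt_mid mulrDr mulrDl.
Qed.

Lemma deg_form h (m : tot A) y z : tg m = gone -> inmod h y -> inmod h z ->
  deg gone (mform m y z).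
Proof.
move=> me hy hz; elim: y hy => [_|p y IH /= [hp /IH hy]].
  by rewrite /mform big_nil; exact: deg0.
rewrite /mform big_cons; apply: degD => //.
elim: z hz {IH hy} => [_|q z IH /= [hq /IH hz]]; first by rewrite big_nil; exact: deg0.
rewrite big_cons; apply: degD => //.
apply: degM' (degM (deg_star hp) (deg_Tt _)) hq _.
by rewrite /tg /= (me : projT1 m = gone) !(homE phiM) !grpE.
Qed.

(** [T] is bounded only fibre by fibre, but the degree of [s0^* x s] does not depend on [x], so
    neither does [K]. A small [s0^* x] then makes the whole row of [s0] small. *)
Lemma nb_cross_le h s0 b0 y : inmod h [:: (s0, b0)] -> inmod h y ->
  exists2 K : R, 0 <= K & forall x : EA,
    nb (mform (tin A x) [:: (s0, b0)] y) <= K * nrT (tm (tst s0) (tin A x)).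
Proof.
move=> db0; elim: y => [_|[s b] y IH /= [db hy]].
  by exists 0 => // x; rewrite /mform big_seq1 big_nil nb0 mul0r.
have [K K0 hK] := IH hy.
have [L L0 hL] := Tt_bndT (gm (ginv (tg s0)) (gm gone (tg s))).
exists (nb b0 * L * nrT s * nb b + K).
  by rewrite addr_ge0 // !mulr_ge0 ?nb_ge0 // nrT_ge0.
move=> x; have -> : mform (tin A x) [:: (s0, b0)] ((s, b) :: y) =
    mform (tin A x) [:: (s0, b0)] [:: (s, b)] + mform (tin A x) [:: (s0, b0)] y.
  by rewrite /mform !big_seq1 big_cons.
have hs : inmod h [:: (s, b)] by [].
have xe : tg (tin A x) = gone by [].
rewrite mulrDl.
apply: (le_trans (nbD (deg_form xe db0 hs) (deg_form xe db0 hy))); apply: lerD => //.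
rewrite /mform !big_seq1 /=; set t := tm (tst s0) (tm _ _).
have [db0' _] := db0.
have dt : deg (phi (tg t)) (TT t) := deg_Tt t.
apply: (le_trans (nbM (degM (deg_star db0') dt) db)).
have := nbM (deg_star db0') dt; rewrite (nb_star db0').
have ht : nrT t <= nrT (tm (tst s0) (tin A x)) * nrT s by rewrite /t tmA; exact: nrTM.
set w := nrT (tm _ _) in ht *; have := hL t erefl.
move: (nb_ge0 (gstar b0 * TT t)) (nb_ge0 b) (nb_ge0 b0) (nb_ge0 (TT t)).
move: (nb _) (nb b) (nb b0) (nb (TT t)) => a1 a2 a3 a4 a10 a20 a30 a40 h1 h2.
have -> : a3 * L * nrT s * a2 * w = (a3 * (L * (w * nrT s))) * a2 by ring.
apply: ler_wpM2r => //; apply: (le_trans h2); apply: ler_wpM2l => //.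
by apply: (le_trans h1); apply: ler_wpM2l.
Qed.

Lemma fmulZl g g' (c : C) (a : fib A g) (b : fib A g') : fmul A (c *: a) b = c *: fmul A a b.
Proof. by rewrite -[c *: a]addr0 fmul_linl fmul0l addr0. Qed.
Lemma fmulZr g g' (c : C) (a : fib A g) (b : fib A g') : fmul A a (c *: b) = c *: fmul A a b.
Proof. by rewrite -[c *: b]addr0 fmul_linr fmul0r addr0. Qed.
Lemma fstarZR g (r : R) (a : fib A g) : fstar A (r :*: a) = r :*: fstar A a.
Proof.
rewrite -[r :*: a]addr0 fstar_conjlin fstar0 addr0; congr (_ *: _).
by apply/eqP; rewrite eq_complex /= oppr0 !eqxx.
Qed.
Lemma trfZ g g' (e : g = g') (c : C) (a : fib A g) : trf e (c *: a) = c *: trf e a.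
Proof. by case: g' / e. Qed.

(* [c^* c = s0 s0^* / M] and [q^2 = 1 - c^* c]. *)
Lemma small_powers (s0 : tot A) : exists (M : R) (p0 q : EA) (c : tot A),
  [/\ 0 < M, cstar q = q, q * q + p0 = 1 & tin A p0 = tm (tst c) c] /\
  (tg c = ginv (tg s0) /\ forall m, m.+1%:R * nrT (tm (tin A (q ^+ m)) s0) ^+ 2 <= M).
Proof.
case: s0 => g a; have e : gm g (ginv g) = gone by rewrite gmxV.
pose z0 : EA := trf e (fmul A a (fstar A a)).
have z0E : tin A z0 = tm (tin A a) (tst (tin A a)) by rewrite trfE.
(* The summand 1 makes [M] positive even if [a] is zero. *)
pose M := nr z0 + 1.
have M0 : 0 < M by rewrite ltr_pwDr // nr_ge0.
have Mi : 0 < M^-1 by rewrite invr_gt0.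
pose p0 : EA := M^-1 :*: z0.
have pz : psd z0.
  by apply: (@psd_gram _ _ _ (fstar A a)); rewrite z0E -{1}[tin A a]tstK.
have pp : psd p0 by apply: psdZ => //; exact: ltW.
have p1 : nr p0 <= 1.
  by rewrite nrZR gtr0_norm // ler_pdivrMl // mulr1 lerDl.
have := psd_le_nr (psd_sa pp) p1; rewrite rscale1 => pq.
have [q [qs qE _ qc]] := psd_root pq.
exists M, p0, q, (tst (tin A ((Num.sqrt M)^-1 :*: a))); split; split => //.
- by rewrite -qE; abel.
- rewrite tstK /tm /tst /= fstarZR fmulZl fmulZr rscaleA -invfM sqrtr_sqrt ?ltW //.
  by rewrite /p0 /z0 -trfZ trfE.
(* The C*-identity turns the squared norm of [q^m a] into the norm of [q^m z0 q^m], which is [M]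
   times that of [(1 - q q) (q q)^m]. *)
move=> m; have -> : nrT (tm (tin A (q ^+ m)) (tin A a)) ^+ 2 = nr (q ^+ m * z0 * q ^+ m).
  rewrite -nrT_Cstar; apply: nr_eqT.
  rewrite surjective_existT !tinM z0E tstM -cstarE cstarX qs !tmA //.
have -> : z0 = M :*: p0 by rewrite rscaleA mulfV ?gt_eqF // rscale1.
rewrite rscaleMr rscaleMl nrZR gtr0_norm // mulrCA -[leRHS]mulr1 ler_pM2l //.
have p0E : p0 = 1 - q * q by rewrite -qE; abel.
have -> : q ^+ m * p0 * q ^+ m = (1 - q * q) * (q * q) ^+ m.
  have c1 : GRing.comm (q ^+ m) (1 - q * q).
    apply: commrB; first exact: commr1.
    by apply: commrM; apply: commr_sym; apply: commrX.
  by rewrite p0E c1 exprMn_comm // mulrA.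
apply: nr_1B_powers; first by exists q.
by rewrite -qE; have := psd_norm pp p1; rewrite rscale1.
Qed.

(** The middle element [q^n q^n] is split as [q^n (q q + p0) q^n]; its part with [p0] is the inner
    square of the family moved by [c q^n]. *)
Lemma ip_decomp (q p0 : EA) (c : tot A) y n :
  cstar q = q -> q * q + p0 = 1 -> tin A p0 = tm (tst c) c ->
  (forall j, pos (ip (lact (tm c (tin A (q ^+ j))) y) (lact (tm c (tin A (q ^+ j))) y))) ->
  exists2 P, pos P & ip y y = ip (lact (tin A (q ^+ n)) y) (lact (tin A (q ^+ n)) y) + P.
Proof.
move=> qs qp p0c pj; have qns m : tst (tin A (q ^+ m)) = tin A (q ^+ m).
  by rewrite -cstarE cstarX qs.
elim: n => [|n [P pP ->]].
  by exists 0; [exact: pos0 | rewrite addr0 form_act qns (tm1s (tot1 A)) form1].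
exists (ip (lact (tm c (tin A (q ^+ n))) y) (lact (tm c (tin A (q ^+ n))) y) + P).
  exact: posD.
rewrite addrA; congr (_ + _); rewrite !form_act tstM !qns.
have -> : tm (tm (tin A (q ^+ n)) (tst c)) (tm c (tin A (q ^+ n))) = tin A (q ^+ n * p0 * q ^+ n).
  by rewrite !tinM p0c !tmA.
rewrite -!tinM -formD; congr (mform _ _ _); congr (tin A _).
by rewrite {2}exprS exprSr !mulrA -mulrDl -(mulrA _ q q) -mulrDr qp mulr1.
Qed.

Theorem pos_ip h y : inmod h y -> pos (ip y y).
Proof.
move: {2}(size y) (erefl (size y)) => n; elim: n h y => [|n IH] h [|[s0 b0] y] //=.
  by move=> _ _; rewrite /ip pairing_nil; exact: pos0.
move=> [sy] [db0 hy].
have h0 : inmod h [:: (s0, b0)] by [].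
have hy0 : inmod h ((s0, b0) :: y) by [].
have [M [p0 [q [c [[M0 qs qp p0c] [cg hm]]]]]] := small_powers s0.
have pj j : pos (ip (lact (tm c (tin A (q ^+ j))) ((s0, b0) :: y))
                    (lact (tm c (tin A (q ^+ j))) ((s0, b0) :: y))).
  set t := tm c _; apply: (pos_ip_cons (h := gm (phi (tg t)) h)).
  - by rewrite /t /tg /= (cg : projT1 c = _) !grpE.
  - exact: (inmod_act t hy0).
  - by apply: IH (inmod_act t hy); rewrite size_map.
have [K K0 hK] := nb_cross_le h0 h0; have [L L0 hL] := nb_cross_le h0 hy.
apply: pos_closed; first by have := deg_ip hy0 hy0; rewrite gmVx.
(* The error consists of the diagonal term of [s0] and two cross terms, bounded by [K w], [L w] and
   [L w], where [w] is the norm of [s0^* q^(2n')]; the summand 1 makes [D] positive. *)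
move=> e e0; pose D := K + L + L + 1.
have D0 : 0 < D by rewrite ltr_wpDl // !addr_ge0.
(* Chosen so that [M / (n' + 1)] is below [(e / D)^2], which forces [w <= e / D]. *)
have [n' hn] := inv_natS_small (e := (e / D) ^+ 2 / M) ltac:(by rewrite divr_gt0 // exprn_gt0 // divr_gt0).
have [P pP ->] := ip_decomp (y := (s0, b0) :: y) n' qs qp p0c pj.
have qns m : tst (tin A (q ^+ m)) = tin A (q ^+ m) by rewrite -cstarE cstarX qs.
set t := tin A (q ^+ n').
exists (ip (lact t y) (lact t y) + P).
  by apply: posD => //; apply: IH (inmod_act t hy); rewrite size_map.
have tt : tm (tst t) t = tin A (q ^+ (n' + n')).
  by rewrite /t qns -tinM -exprD.
rewrite -cat1s.
have -> : lact t ([:: (s0, b0)] ++ y) = lact t [:: (s0, b0)] ++ lact t y by rewrite /lact map_cat.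
rewrite ip_catl !ip_catr -[ip (lact t y) (lact t [:: (s0, b0)])]ip_star.
set U := ip _ _; set V := ip _ (lact t y).
have -> : U + V + (gstar V + ip (lact t y) (lact t y)) + P - (ip (lact t y) (lact t y) + P) =
  U + V + gstar V by abel.
have te : tg (tm (tst t) t) = gone by rewrite /tg /= !grpE.
have dU : deg gone U by rewrite /U form_act; exact: (deg_form te h0 h0).
have dV : deg gone V by rewrite /V form_act; exact: (deg_form te h0 hy).
have dV' : deg gone (gstar V) by rewrite -ginv1; exact: deg_star.
have UE : nb U <= K * nrT (tm (tst s0) (tin A (q ^+ (n' + n')))).
  by rewrite /U form_act tt; exact: hK.
have VE : nb V <= L * nrT (tm (tst s0) (tin A (q ^+ (n' + n')))).
  by rewrite /V form_act tt; exact: hL.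
apply: (le_trans (nbD (degD dU dV) dV')); rewrite (nb_star dV).
have := nbD dU dV; move: UE VE.
have := hm (n' + n')%N; rewrite -nrT_star tstM qns.
have := nrT_ge0 (tm (tst s0) (tin A (q ^+ (n' + n')))); set w := nrT _ => wp hw UE VE UV.
have wle : w <= e / D.
  have ed : 0 <= e / D by rewrite divr_ge0 ?ltW.
  rewrite -(ler_pXn2r (n := 2)) ?nnegrE //.
  have l : n'.+1%:R <= (n' + n').+1%:R :> R by rewrite ler_nat ltnS leq_addr.
  have h1 : n'.+1%:R * w ^+ 2 <= M.
    by apply: le_trans hw; apply: ler_wpM2r => //; exact: sqr_ge0.
  have h2 : M < (e / D) ^+ 2 * n'.+1%:R.
    by move: hn; rewrite ltr_pdivlMr // mulrC ltr_pdivrMr // ?ltr0n.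
  have n0 : 0 < n'.+1%:R :> R by rewrite ltr0n.
  by rewrite -(ler_pM2l n0) (le_trans h1) // ltW // mulrC.
have : D * w <= e by move: wle; rewrite ler_pdivlMr // mulrC.
rewrite /D !mulrDl mul1r; move: UE VE UV wp; move: (K * w) (L * w) (nb U) (nb V) (nb (U + V)).
move=> *; lra.
Qed.

(** * The dual norm *)

Definition mnorm y : R := Num.sqrt (nb (ip y y)).

Lemma mnorm_ge0 y : 0 <= mnorm y. Proof. exact: sqrtr_ge0. Qed.
Lemma mnorm_sqr y : mnorm y ^+ 2 = nb (ip y y).
Proof. by rewrite sqr_sqrtr // nb_ge0. Qed.

(** For [r] above the norm of [<y,y>], the inner square of [z - y v / r] is positive and
    [<y,y> <= r]; together these give [v^* v / r <= <z,z>]. Taking [r] strictly larger covers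
    [<y,y> = 0]. *)
Lemma ip_CS h k y z : inmod h y -> inmod k z -> nb (ip y z) <= mnorm y * mnorm z.
Proof.
move=> hy hz; set v := ip y z.
have dv : deg (gm (ginv h) k) v := deg_ip hy hz.
have key (r : R) : nb (ip y y) < r -> nb v ^+ 2 <= r * nb (ip z z).
  move=> yt; have t0 : 0 < r := le_lt_trans (nb_ge0 _) yt.
  pose w : alg := (- r^-1) :*: v.
  have pL : pos (ip (rmul y w ++ z) (rmul y w ++ z)).
    apply: (@pos_ip k); apply: inmod_cat => //.
    by rewrite -(gmKV h k); apply: inmod_rmul hy; apply: degZ.
  have py : pos (r :*: (1 : alg) - ip y y).
    have dy : deg gone (ip y y) by have := deg_ip hy hy; rewrite gmVx.
    by apply: pos_le_nb (ip_star _ _) (ltW yt).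
  have pv : pos (gstar (r^-1 :*: v) * (r :*: (1 : alg) - ip y y) * (r^-1 :*: v)).
    by apply: pos_conj py; apply: degZ dv.
  have := posD pL pv.
  rewrite !ip_catl !ip_catr !ip_rmull !ip_rmulr -/v.
  have -> : ip z y = gstar v by rewrite ip_star.
  have gr (a : R) x : gstar (a :*: x) = a :*: gstar x.
    by rewrite gstarZ; congr (_ *: _); apply/eqP; rewrite eq_complex /= oppr0 !eqxx.
  set q := gstar v * ip y y * v; set p := gstar v * v; set c := r^-1.
  have -> : gstar w * (ip y y * w) = (c * c) :*: q.
    by rewrite /w gr !(gZAl, gZAr) rscaleA mulrNN mulrA.
  have -> : gstar w * v = - (c :*: p) by rewrite /w gr gZAl rscaleNl.
  have -> : gstar v * w = - (c :*: p) by rewrite /w gZAr rscaleNl.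
  have -> : gstar (c :*: v) * (r :*: (1 : alg) - ip y y) * (c :*: v) = c :*: p - (c * c) :*: q.
    have cr : c * r = 1 by rewrite /c mulVf // gt_eqF.
    rewrite gr mulrBr mulrBl !(gZAl, gZAr) mulr1 !rscaleA.
    by rewrite -[c * c * r]mulrA cr mulr1.
  have -> : (c * c) :*: q + - (c :*: p) + (- (c :*: p) + ip z z) + (c :*: p - (c * c) :*: q)
    = ip z z - c :*: p by abel.
  move=> pp.
  have pc : pos (c :*: p) by apply: posZ; [rewrite invr_ge0 ltW | exact: pos_gram dv].
  have := pos_nb_mono pc pp.
  have dp : deg gone p by apply: pos_deg; exact: pos_gram dv.
  by rewrite (nbZR _ dp) gtr0_norm ?invr_gt0 // ler_pdivrMl // (nb_Cstar dv).
have : nb v ^+ 2 <= nb (ip y y) * nb (ip z z).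
  have z0 := nb_ge0 (ip z z).
  apply/ler_addgt0Pr => e e0; pose b := nb (ip z z) + 1.
  have b0 : 0 < b by rewrite ltr_wpDl.
  have := key (nb (ip y y) + e / b); rewrite ltrDl divr_gt0 // => /(_ isT) h1.
  apply: (le_trans h1); rewrite mulrDl lerD2l -mulrA ler_piMr ?(ltW e0) //.
  by rewrite ler_pdivrMl // mulr1 /b lerDl.
rewrite -!mnorm_sqr -exprMn ler_pXn2r ?nnegrE ?nb_ge0 ?mulr_ge0 ?mnorm_ge0 //.
Qed.

Lemma T0 g : T (0 : fib A g) = 0.
Proof.
have := (Tb g).1 1 0 0; rewrite !scale1r addr0 => e.
by apply: (addrI (T (0 : fib A g))); rewrite -e addr0.
Qed.

Lemma Tt_midZ (u v : tot A) (c : C) (x : EA) :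
  TT (tm u (tm (tin A (c *: x)) v)) = c *: TT (tm u (tm (tin A x) v)).
Proof.
have -> : tm u (tm (tin A (c *: x)) v) =
    tin A (c *: fmul A (projT2 u) (fmul A (x : fib A gone) (projT2 v))).
  by rewrite -fmulZr -fmulZl.
rewrite -[c *: _ in LHS]addr0 Tt_lin.
by rewrite [TT (tin A 0)]/TT /= T0 emb0 addr0.
Qed.

Lemma formZ (c : C) (x : EA) y z : mform (tin A (c *: x)) y z = c *: mform (tin A x) y z.
Proof.
rewrite /mform scaler_sumr; apply: eq_bigr => p _; rewrite scaler_sumr.
by apply: eq_bigr => q _ /=; rewrite Tt_midZ gZAr gZAl.
Qed.

(** The element [nrT s ^ 2 - s^* s] of the unit fibre is a square [q q], so [<s y, s y>] and
    [<q y, q y>] add up to [nrT s ^ 2] times [<y,y>]. *)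
Lemma mnorm_act h s y : inmod h y -> mnorm (lact s y) <= nrT s * mnorm y.
Proof.
move=> hy; case: s => g a; set s := tin A a.
have e : gm (ginv g) g = gone by rewrite gmVx.
pose z0 : EA := trf e (fmul A (fstar A a) a).
have z0E : tin A z0 = tm (tst s) s by rewrite trfE.
have nz : nr z0 = nrT s ^+ 2 by rewrite nr_trf nr_Cstar.
have pz : psd z0 by apply: (@psd_gram _ _ _ a).
have := psd_le_nr (psd_sa pz) (lexx _); rewrite nz; set r := nrT s ^+ 2.
move=> [q qs qE].
have dy : deg gone (ip y y) by have := deg_ip hy hy; rewrite gmVx.
have e1 : r :*: ip y y = ip (lact s y) (lact s y) + ip (lact (tin A q) y) (lact (tin A q) y).
  rewrite !form_act -cstarE qs -tinM -z0E -qE -formD -form1 -[tot1 A]/(tin A (1 : EA)) -formZ.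
  by congr (mform (tin A _) _ _); abel.
have hsy := inmod_act s hy; have hqy := inmod_act (tin A q) hy.
have : nb (ip (lact s y) (lact s y)) <= nb (r :*: ip y y).
  apply: pos_nb_mono; first exact: pos_ip hsy.
  by rewrite e1 (_ : _ - _ = ip (lact (tin A q) y) (lact (tin A q) y)); [exact: pos_ip hqy | abel].
rewrite (nbZR _ dy) ger0_norm ?sqr_ge0 // -!mnorm_sqr -exprMn.
by rewrite ler_pXn2r // nnegrE ?mulr_ge0 ?mnorm_ge0 ?nr_ge0.
Qed.

(** [c] bounds the dual norm of [f] over all degrees [h] at once; speaking of bounds avoids
    suprema. *)
Definition kbounded (c : R) f :=
  forall h y, inmod h y -> nb (pairing y f) <= c * mnorm y.

(** With [mnorm_le_bound], which tests [kern y] on [y] itself, this identifies the dual norm of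
    [kern y] as [mnorm y]. *)
Lemma bounded_kern k z : inmod k z -> kbounded (mnorm z) (kern z).
Proof. by move=> hz h y hy; rewrite mulrC; exact: ip_CS hy hz. Qed.

Lemma mnorm_le_bound h y (c : R) : 0 <= c -> inmod h y -> kbounded c (kern y) -> mnorm y <= c.
Proof.
move=> c0 hy /(_ _ _ hy); rewrite -mnorm_sqr expr2.
have := mnorm_ge0 y; rewrite le_eqVlt => /orP[/eqP <- //|l0].
by rewrite ler_pM2r.
Qed.

Lemma boundedD k (c c' : R) f f' : graded k f -> graded k f' ->
  kbounded c f -> kbounded c' f' -> kbounded (c + c') (fun s => f s + f' s).
Proof.
move=> gf gf' bf bf' h y hy; rewrite pairingD mulrDl.
apply: (le_trans (nbD (deg_pairing hy gf) (deg_pairing hy gf'))).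
by apply: lerD; [exact: bf hy | exact: bf' hy].
Qed.

Lemma pairingZ y f (a : C) : pairing y (fun s => a *: f s) = a *: pairing y f.
Proof. by rewrite /pairing scaler_sumr; apply: eq_bigr => p _; rewrite gZAr. Qed.

Lemma boundedZ k (a : C) (c : R) f : graded k f ->
  kbounded c f -> kbounded (complex.Re `|a| * c) (fun s => a *: f s).
Proof.
move=> gf bf h y hy; rewrite pairingZ (nbZ _ (deg_pairing hy gf)) -mulrA.
apply: ler_wpM2l; last exact: bf hy.
by rewrite -lecR; have := normr_ge0 a; case: (`|a|) => u v; rewrite !lecE /= eqxx => /andP[].
Qed.

Lemma bounded_ext c f f' : f =1 f' -> kbounded c f -> kbounded c f'.
Proof. by move=> /funext ->. Qed.

Lemma bounded_le (c c' : R) f : c <= c' -> kbounded c f -> kbounded c' f.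
Proof.
move=> cc bf h y hy; apply: (le_trans (bf _ _ hy)).
by apply: ler_wpM2r => //; exact: mnorm_ge0.
Qed.

Lemma bounded_act (c : R) f s : 0 <= c -> kbounded c f -> kbounded (c * nrT s) (f \o tm s).
Proof.
move=> c0 bf h y hy; rewrite -pairing_act -mulrA.
apply: (le_trans (bf _ _ (inmod_act s hy))); apply: ler_wpM2l => //; exact: mnorm_act hy.
Qed.

Lemma bounded_mulr k l (c : R) f b : graded k f -> deg l b ->
  kbounded c f -> kbounded (c * nb b) (fun s => f s * b).
Proof.
move=> gf db bf h y hy; rewrite pairing_mulr.
apply: (le_trans (nbM (deg_pairing hy gf) db)); rewrite mulrAC.
by apply: ler_wpM2r; [exact: nb_ge0 | exact: bf hy].
Qed.

Lemma inmod_one s : inmod (phi (tg s)) [:: (s, 1)].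
Proof. by split => //; rewrite gmVx; exact: deg1. Qed.

Lemma pairing_one s f : pairing [:: (s, 1)] f = f s.
Proof. by rewrite pairing_cons pairing_nil gstar1 mul1r addr0. Qed.

Lemma bounded_eval (c : R) f s : kbounded c f -> nb (f s) <= c * mnorm [:: (s, 1)].
Proof. by move=> bf; have := bf _ _ (inmod_one s); rewrite pairing_one. Qed.

Lemma bounded0 k f : graded k f -> kbounded 0 f -> f =1 fun=> 0.
Proof.
move=> gf bf s; apply: (nb_eq0 (gf s)); apply/eqP; rewrite eq_le nb_ge0 andbT.
by have := bounded_eval s bf; rewrite mul0r.
Qed.

Lemma gradedD k f f' : graded k f -> graded k f' -> graded k (fun s => f s + f' s).
Proof. by move=> gf gf' s; apply: degD. Qed.
Lemma gradedZ k (a : C) f : graded k f -> graded k (fun s => a *: f s).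
Proof. by move=> gf s; apply: degZ. Qed.
Lemma gradedB k f f' : graded k f -> graded k f' -> graded k (fun s => f s - f' s).
Proof. by move=> gf gf' s; apply: degB. Qed.

Lemma gradedM k l f b : graded k f -> deg l b -> graded (gm k l) (fun s => f s * b).
Proof. by move=> gf db s; apply: degM' (gf s) db _; rewrite !grpE. Qed.

Lemma graded_act k f t : graded k f -> graded (gm (phi (ginv (tg t))) k) (f \o tm t).
Proof.
move=> gf s; have := gf (tm t s).
by rewrite -[tg (tm t s)]/(gm (tg t) (tg s)) !(homE phiM) !grpE.
Qed.

(** * The reproducing kernel bundle *)

(** Imposed fibre by fibre, since [tot A] is a mere disjoint union. It makes [rho(a) f], whose value
    at [s] is that of [f] at [a^* s], linear in [a]. *)
Definition antilinear f := forall g (c : C) (a a' : fib A g),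
  f (tin A (c *: a + a')) = Num.conj c *: f (tin A a) + f (tin A a').

Definition approximable h f := forall e : R, 0 < e ->
  exists2 y, inmod h y & kbounded e (fun s => f s - kern y s).

(* The fibre at [h] of the reproducing kernel bundle: [f s] plays the role of
   the inner product of [s (x) 1] with [f]. *)
Definition inX h f := [/\ graded h f, antilinear f & approximable h f].

Lemma antilinear_kern y : antilinear (kern y).
Proof.
move=> g c a a'; rewrite /kern scaler_sumr -big_split; apply: eq_bigr => -[t b] _ /=.
have -> : tm (tst (tin A (c *: a + a'))) t =
    tin A (Num.conj c *: fmul A (fstar A a) (projT2 t) + fmul A (fstar A a') (projT2 t)).
  by rewrite -fmul_linl -fstar_conjlin.
by rewrite Tt_lin mulrDl gZAl.
Qed.

Lemma bounded_zero (c : R) f : 0 <= c -> f =1 (fun=> 0) -> kbounded c f.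
Proof.
move=> c0 f0 h y hy; rewrite /pairing big1 ?nb0 ?mulr_ge0 ?mnorm_ge0 // => p _.
by rewrite f0 mulr0.
Qed.

Lemma inX_kern h y : inmod h y -> inX h (kern y).
Proof.
move=> hy; split; [exact: graded_kern | exact: antilinear_kern |].
move=> e e0; exists y => //; apply: bounded_zero => [|s]; first exact: ltW.
by rewrite subrr.
Qed.

Lemma Cabs_ge0 (c : C) : 0 <= complex.Re `|c|.
Proof. by rewrite -lecR; have := normr_ge0 c; case: (`|c|) => u v; rewrite !lecE /= eqxx => /andP[]. Qed.

Lemma inX_comb h (c : C) f f' : inX h f -> inX h f' -> inX h (fun s => c *: f s + f' s).
Proof.
move=> [gf lf af] [gf' lf' af']; split.
- exact: gradedD (gradedZ _ gf) gf'.
- move=> g k a a'; rewrite lf lf' !scalerDr !scalerA [c * _]mulrC.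
  by rewrite addrACA.
move=> e e0; pose K := complex.Re `|c| + 1.
have K0 : 0 < K by rewrite ltr_wpDl // Cabs_ge0.
have [y hy yb] := af (e / K / 2) ltac:(by rewrite !divr_gt0).
have [z hz bz] := af' (e / 2) ltac:(by rewrite divr_gt0).
exists (rmul y (c *: (1 : alg)) ++ z).
  apply: inmod_cat => //; rewrite -[h]gmx1; apply: inmod_rmul hy.
  by apply: degZ; exact: deg1.
have gy := gradedB gf (graded_kern hy); have gz := gradedB gf' (graded_kern hz).
have := boundedD (gradedZ c gy) gz (boundedZ c gy yb) bz.
move=> bb; apply: bounded_le (bounded_ext _ bb) => [|s].
  rewrite [leRHS](_ : e = e / 2 + e / 2); last by field.
  rewrite lerD2r mulrA ler_pM2r ?invr_gt0 // mulrCA ler_piMr ?(ltW e0) //.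
  by rewrite ler_pdivrMr // mul1r /K lerDl.
rewrite kern_cat kern_rmul gZAr mulr1 scalerBr; abel.
Qed.

Lemma inX0 h : inX h (fun=> 0).
Proof.
split; first by move=> s; exact: deg0.
- by move=> g c a a'; rewrite scaler0 addr0.
move=> e e0; exists [::] => //; apply: bounded_zero => [|s]; first exact: ltW.
by rewrite /kern big_nil subrr.
Qed.

Lemma inX_mulr h l f b : inX h f -> deg l b -> inX (gm h l) (fun s => f s * b).
Proof.
move=> [gf lf af] db; split; first exact: gradedM.
- by move=> g c a a'; rewrite lf mulrDl gZAl.
move=> e e0; have b1 : 0 < nb b + 1 by rewrite ltr_wpDl // nb_ge0.
have [y hy yb] := af (e / (nb b + 1)) ltac:(by rewrite divr_gt0).
exists (rmul y b); first exact: inmod_rmul.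
have := bounded_mulr (gradedB gf (graded_kern hy)) db yb.
move=> bb; apply: bounded_le (bounded_ext _ bb) => [|s].
  by rewrite mulrAC ler_pdivrMr // ler_pM2l // lerDl.
by rewrite kern_rmul mulrBl.
Qed.

Lemma inX_act h f s : inX h f -> inX (gm (phi (tg s)) h) (f \o tm (tst s)).
Proof.
move=> [gf lf af]; split.
- have := graded_act (tst s) gf; rewrite [tg (tst s)]/(ginv _) !(homE phiM) ginvK //.
- move=> g c a a' /=.
  have -> : tm (tst s) (tin A (c *: a + a')) =
    tin A (c *: fmul A (fstar A (projT2 s)) a + fmul A (fstar A (projT2 s)) a').
    by rewrite -fmul_linr.
  exact: lf.
move=> e e0; have b1 : 0 < nrT s + 1 by rewrite ltr_wpDl // nrT_ge0.
have [y hy yb] := af (e / (nrT s + 1)) ltac:(by rewrite divr_gt0).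
exists (lact s y); first exact: inmod_act.
have e0' : 0 <= e / (nrT s + 1) by rewrite divr_ge0 ?ltW.
have := bounded_act (tst s) e0' yb.
move=> bb; apply: bounded_le (bounded_ext _ bb) => [|t] /=.
  by rewrite nrT_star mulrAC ler_pdivrMr // ler_pM2l // lerDl.
by rewrite kern_act.
Qed.

(** * Extension of the inner product to limits *)

Lemma inX_bounded h f : inX h f -> exists2 M : R, 0 <= M & kbounded M f.
Proof.
move=> [gf _ af]; have [y hy yb] := af 1 ltr01.
exists (1 + mnorm y); first by rewrite addr_ge0 // mnorm_ge0.
have := boundedD (gradedB gf (graded_kern hy)) (graded_kern hy) yb (bounded_kern hy).
by apply: bounded_ext => s; rewrite subrK.
Qed.

(** Two approximants of [f] differ by a vector whose [mnorm] is at most [e + e'], because its kernel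
    function has that bound. *)
Lemma approx_dist h f y y' (e e' : R) : graded h f -> inmod h y -> inmod h y' ->
  kbounded e (fun s => f s - kern y s) -> kbounded e' (fun s => f s - kern y' s) ->
  0 <= e -> 0 <= e' ->
  forall k f' (M : R), graded k f' -> kbounded M f' -> 0 <= M ->
    nb (pairing y f' - pairing y' f') <= (e + e') * M.
Proof.
move=> gf hy hy' b b' e0 e0' k f' M gf' bf' M0.
(* Lists represent vectors without subtraction, so [y'] is multiplied by -1 from the right. *)
pose m1 : alg := (-1 : C) *: (1 : alg).
have d1 : deg gone m1 by apply: degZ; exact: deg1.
have hz : inmod h (rmul y' m1 ++ y).
  by apply: inmod_cat => //; rewrite -[h]gmx1; apply: inmod_rmul hy'.
have -> : pairing y f' - pairing y' f' = pairing (rmul y' m1 ++ y) f'.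
  rewrite pairing_cat pairing_rmul /m1 gstarZ rmorphN rmorph1 gstar1 scaleN1r mulN1r.
  by rewrite addrC.
apply: (le_trans (bf' _ _ hz)); rewrite mulrC; apply: ler_wpM2r => //.
apply: (mnorm_le_bound (addr_ge0 e0 e0') hz).
have g1 := gradedB gf (graded_kern hy); have g2 := gradedB gf (graded_kern hy').
have := boundedD (gradedZ (-1) g1) g2 (boundedZ (-1) g1 b) b'.
rewrite normrN normr1 mul1r; apply: bounded_ext => s.
by rewrite kern_cat kern_rmul /m1 gZAr mulr1 !scaleN1r; abel.
Qed.

(* The inner product of [f] and [f'] is the limit of the pairings of
   approximants of [f] with [f']. *)
Definition is_hip h k f f' (v : alg) := deg (gm (ginv h) k) v /\
  forall (e : R) y (M : R), 0 <= e -> 0 <= M -> inmod h y ->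
    kbounded e (fun s => f s - kern y s) -> kbounded M f' -> nb (v - pairing y f') <= e * M.

Lemma hip_exists h k f f' : inX h f -> inX k f' ->
  exists v : fib B (gm (ginv h) k), is_hip h k f f' (emb (tin B v)).
Proof.
move=> hf hf'; have [gf _ af] := hf; have [gf' _ _] := hf'.
have /choice[y hy] : forall n, exists y, inmod h y /\ kbounded n.+1%:R^-1 (fun s => f s - kern y s).
  by move=> n; have [|y hy b] := af n.+1%:R^-1; [rewrite invr_gt0 ltr0n | exists y].
have i0 n : 0 <= n.+1%:R^-1 :> R by rewrite invr_ge0 ler0n.
have dp n : deg (gm (ginv h) k) (pairing (y n) f') := deg_pairing (hy n).1 gf'.
have [M0 M00 bM0] := inX_bounded hf'.
pose u n : fib B (gm (ginv h) k) := coef (gm (ginv h) k) (pairing (y n) f').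
have uE n : emb (tin B (u n)) = pairing (y n) f' by exact: emb_coef.
(* [approx_dist] gives the bound [(1/(n+1) + 1/(m+1)) M0], at most [2 M0 / (n+1)] for [n <= m]. *)
have [||v hv] := @complete_seq _ u (fun n => 2 * M0 * n.+1%:R^-1).
- move=> n m nm; rewrite -nb_emb embB !uE.
  apply: (le_trans (approx_dist gf (hy m).1 (hy n).1 (hy m).2 (hy n).2 _ _ gf' bM0 M00)) => //.
  rewrite [leRHS]mulrAC; apply: ler_wpM2r => //.
  rewrite mulr_natl mulr2n lerD2r.
  by rewrite lef_pV2 ?posrE ?ltr0n // ler_nat.
- move=> e e0; have [n hn] := inv_natS_small (e := e / (2 * M0 + 1))
    ltac:(by rewrite divr_gt0 // ltr_wpDl // mulr_ge0).
  exists n; have K0 : 0 < 2 * M0 + 1 by rewrite ltr_wpDl // mulr_ge0.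
  move: hn; rewrite ltr_pdivlMr // => hn; apply: le_lt_trans hn.
  by rewrite mulrC ler_wpM2l // lerDl.
exists v; split; first exact: deg_tin.
move=> e z M e0 M1 hz bz bM; apply/ler_addgt0Pr => d d0.
have [n hn] := inv_natS_small (e := d / (2 * M0 + M + 1))
    ltac:(by rewrite divr_gt0 // ltr_wpDl // addr_ge0 // mulr_ge0).
have -> : emb (tin B v) - pairing z f' =
  emb (tin B (v - u n)) + (pairing (y n) f' - pairing z f') by rewrite embB uE; abel.
apply: (le_trans (nbD (deg_tin _) (degB (dp n) (deg_pairing hz gf')))).
have h1 := approx_dist gf (hy n).1 hz (hy n).2 bz (i0 n) e0 gf' bM M1.
have h2 := hv n; rewrite nb_emb.
have K0 : 0 < 2 * M0 + M + 1 by rewrite ltr_wpDl // addr_ge0 // mulr_ge0.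
move: hn; rewrite ltr_pdivlMr // => hn.
move: h1 h2; rewrite mulrDl; move: hn (i0 n) (nb _) (nr _) => /=.
set w := n.+1%:R^-1; rewrite !mulrDr mulr1 (mulrC w (2 * M0)).
by move: (w * M) (e * M) (2 * M0 * w); intros; lra.
Qed.

(** Stands for letting [e] tend to 0. The restriction [e <= 1] lets errors quadratic in [e] be
    absorbed into [K]. *)
Lemma le0_eps (x K : R) : (forall e, 0 < e -> e <= 1 -> x <= e * K) -> x <= 0.
Proof.
move=> h; apply/ler_addgt0Pr => e e0; rewrite add0r.
have K1 : 0 < `|K| + 1 by rewrite ltr_wpDl.
have m0 : 0 < Num.min (e / (`|K| + 1)) 1 by rewrite lt_min ltr01 divr_gt0.
apply: (le_trans (h _ m0 _)); first by rewrite ge_min lexx orbT.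
set d := Num.min _ _ in m0 *.
have : d <= e / (`|K| + 1) by rewrite ge_min lexx.
rewrite ler_pdivlMr // => h1; have := ler_norm K; move: m0 h1 e0.
by move: d `|K| => d k *; nra.
Qed.

Lemma pairingB y f f' : pairing y (fun s => f s - f' s) = pairing y f - pairing y f'.
Proof. by rewrite /pairing -sumrB; apply: eq_bigr => p _; rewrite mulrBr. Qed.

Definition hv h k f f' : fib B (gm (ginv h) k) :=
  if pselect (exists v : fib B (gm (ginv h) k), is_hip h k f f' (emb (tin B v)))
  is left e then projT1 (cid e) else 0.
Definition hva h k f f' : alg := emb (tin B (hv h k f f')).

Lemma hvaP h k f f' : inX h f -> inX k f' -> is_hip h k f f' (hva h k f f').
Proof.
move=> hf hf'; rewrite /hva /hv; case: pselect => [e|]; first by case: (cid e).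
by case; exact: hip_exists.
Qed.

Lemma deg_hva h k f f' : deg (gm (ginv h) k) (hva h k f f').
Proof. exact: deg_tin. Qed.

Lemma eq0_nb g x (K : R) : deg g x -> (forall e, 0 < e -> e <= 1 -> nb x <= e * K) -> x = 0 :> alg.
Proof. by move=> dx /le0_eps h; apply: (nb_eq0 dx); apply/eqP; rewrite eq_le h nb_ge0. Qed.

Lemma hva_uniq h k f f' v (K : R) : inX h f -> inX k f' -> deg (gm (ginv h) k) v ->
  (forall (e : R) y, 0 < e -> inmod h y -> kbounded e (fun s => f s - kern y s) ->
     nb (v - pairing y f') <= e * K) -> v = hva h k f f'.
Proof.
move=> hf hf' dv hK; have [M M0 bM] := inX_bounded hf'.
have [dh hh] := hvaP hf hf'; have [_ _ af] := hf; have [gf' _ _] := hf'.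
apply/eqP; rewrite -subr_eq0; apply/eqP; apply: (eq0_nb (K := K + M) (degB dv dh)) => e e0 _.
have [y hy yb] := af e e0; have dp := deg_pairing hy gf'.
have -> : v - hva h k f f' = (v - pairing y f') - (hva h k f f' - pairing y f') by abel.
apply: (le_trans (nbB (degB dv dp) (degB dh dp))); rewrite mulrDr.
by apply: lerD; [exact: hK | apply: hh => //; exact: ltW].
Qed.

Lemma hva_comb h k f f' f'' (c : C) : inX h f -> inX k f' -> inX k f'' ->
  hva h k f (fun s => c *: f' s + f'' s) = c *: hva h k f f' + hva h k f f''.
Proof.
move=> hf hf' hf''; have [M M0 bM] := inX_bounded hf'; have [M' M0' bM'] := inX_bounded hf''.
have [dh hh] := hvaP hf hf'; have [dh' hh'] := hvaP hf hf''.
have [gf' _ _] := hf'; have [gf'' _ _] := hf''.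
apply/esym; apply: (hva_uniq (K := complex.Re `|c| * M + M')) => //.
- exact: inX_comb.
- by apply: degD => //; apply: degZ.
move=> e y e0 hy yb; have dp := deg_pairing hy gf'; have dp' := deg_pairing hy gf''.
have -> : c *: hva h k f f' + hva h k f f'' - pairing y (fun s => c *: f' s + f'' s)
  = c *: (hva h k f f' - pairing y f') + (hva h k f f'' - pairing y f'').
  by rewrite pairing_comb scalerBr; abel.
apply: (le_trans (nbD (degZ _ (degB dh dp)) (degB dh' dp'))).
rewrite (nbZ _ (degB dh dp)) mulrDr; apply: lerD; last by apply: hh' => //; exact: ltW.
rewrite mulrCA; apply: ler_wpM2l; first exact: Cabs_ge0.
by apply: hh => //; exact: ltW.
Qed.

Lemma hva_mulr h k l f f' b : inX h f -> inX k f' -> deg l b ->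
  hva h (gm k l) f (fun s => f' s * b) = hva h k f f' * b.
Proof.
move=> hf hf' db; have [M M0 bM] := inX_bounded hf'.
have [dh hh] := hvaP hf hf'; have [gf' _ _] := hf'.
apply/esym; apply: (hva_uniq (K := M * nb b)) => //.
- exact: inX_mulr.
- by apply: degM' dh db _; rewrite gmA.
move=> e y e0 hy yb; have dp := deg_pairing hy gf'.
rewrite pairing_mulr -mulrBl; apply: (le_trans (nbM (degB dh dp) db)).
by rewrite mulrA; apply: ler_wpM2r; [exact: nb_ge0 | apply: hh => //; exact: ltW].
Qed.

Lemma hva_act h k f f' s : inX h f -> inX k f' ->
  hva (gm (phi (tg s)) h) k (f \o tm (tst s)) f' =
  hva h (gm (phi (tg (tst s))) k) f (f' \o tm s).
Proof.
move=> hf hf'; have [M M0 bM] := inX_bounded hf'.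
have [dh hh] := hvaP (inX_act s hf) hf'; have [gf' _ _] := hf'.
apply: (hva_uniq (K := nrT s * M)) => //.
- by have := inX_act (tst s) hf'; rewrite tstK.
- by move: dh; rewrite [tg (tst s)]/(ginv _) !(homE phiM) !grpE.
move=> e y e0 hy yb; have e1 := ltW e0.
have := hh (e * nrT s) (lact s y) M; rewrite pairing_act mulrA; apply => //.
- by rewrite mulr_ge0 // nrT_ge0.
- exact: inmod_act.
have := bounded_act (tst s) e1 yb; rewrite nrT_star; apply: bounded_ext => t /=.
by rewrite kern_act.
Qed.

Lemma mnorm_approx h f y (e M : R) : inX h f -> inmod h y -> 0 <= e -> 0 <= M ->
  kbounded e (fun s => f s - kern y s) -> kbounded M f -> mnorm y <= M + e.
Proof.
move=> [gf _ _] hy e0 M0 b bM; apply: (mnorm_le_bound (addr_ge0 M0 e0) hy).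
have g1 := gradedB gf (graded_kern hy).
have := boundedD gf (gradedZ (-1) g1) bM (boundedZ (-1) g1 b).
rewrite normrN normr1 mul1r; apply: bounded_ext => s; rewrite scaleN1r; abel.
Qed.

Lemma hva_ip h k f f' y y' (e M M' : R) : inX h f -> inX k f' ->
  inmod h y -> inmod k y' -> 0 <= e -> e <= 1 -> 0 <= M -> 0 <= M' ->
  kbounded e (fun s => f s - kern y s) -> kbounded e (fun s => f' s - kern y' s) ->
  kbounded M f -> kbounded M' f' ->
  nb (hva h k f f' - ip y y') <= e * (M' + M + 1).
Proof.
move=> hf hf' hy hy' e0 e1 M0 M0' b b' bM bM'.
have [dh hh] := hvaP hf hf'; have [gf' _ _] := hf'.
have dp := deg_pairing hy gf'; have dp' := deg_pairing hy (graded_kern hy').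
have -> : hva h k f f' - ip y y' =
  (hva h k f f' - pairing y f') + (pairing y f' - pairing y (kern y')) by rewrite /ip; abel.
apply: (le_trans (nbD (degB dh dp) (degB dp dp'))).
rewrite -addrA mulrDr; apply: lerD; first exact: hh.
have -> : pairing y f' - pairing y (kern y') = pairing y (fun s => f' s - kern y' s).
  by rewrite -pairingB.
apply: (le_trans (b' _ _ hy)); apply: ler_wpM2l => //.
by apply: (le_trans (mnorm_approx hf hy e0 M0 b bM)); rewrite lerD2l.
Qed.

(** [hva] approximates only its first argument; comparison with [ip y z], which is hermitian,
    restores the symmetry. *)
Lemma hva_star h k f f' : inX h f -> inX k f' -> gstar (hva h k f f') = hva k h f' f.
Proof.
move=> hf hf'; have [M M0 bM] := inX_bounded hf; have [M' M0' bM'] := inX_bounded hf'.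
have [_ _ af] := hf; have [_ _ af'] := hf'.
have d1 : deg (gm (ginv k) h) (gstar (hva h k f f')).
  by have := deg_star (deg_hva h k f f'); rewrite !grpE.
have d2 := deg_hva k h f' f.
apply/eqP; rewrite -subr_eq0; apply/eqP.
apply: (eq0_nb (K := (M' + M + 1) + (M + M' + 1)) (degB d1 d2)) => e e0 e1.
have [y hy yb] := af e e0; have [z hz bz] := af' e e0.
have di := deg_ip hz hy.
have -> : gstar (hva h k f f') - hva k h f' f =
  gstar (hva h k f f' - ip y z) - (hva k h f' f - ip z y) by rewrite gstarB ip_star; abel.
have d3 : deg (gm (ginv h) k) (hva h k f f' - ip y z) := degB (deg_hva h k f f') (deg_ip hy hz).
have d4 : deg (gm (ginv k) h) (gstar (hva h k f f' - ip y z)).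
  by have := deg_star d3; rewrite !grpE.
apply: (le_trans (nbB d4 (degB d2 di))); rewrite (nb_star d3) mulrDr.
by apply: lerD; apply: hva_ip; rewrite // ltW.
Qed.

Lemma hva_pos h f : inX h f -> pos (hva h h f f).
Proof.
move=> hf; have [M M0 bM] := inX_bounded hf; have [_ _ af] := hf.
apply: pos_closed; first by have := deg_hva h h f f; rewrite gmVx.
move=> e e0; pose K := M + M + 1; have K0 : 0 < K by rewrite ltr_wpDl // addr_ge0.
pose d := Num.min (e / K) 1.
have d0 : 0 < d by rewrite lt_min ltr01 divr_gt0.
have d1 : d <= 1 by rewrite ge_min lexx orbT.
have [y hy yb] := af d d0; exists (ip y y); first exact: pos_ip hy.
apply: (le_trans (hva_ip hf hf hy hy (ltW d0) d1 M0 M0 yb yb bM bM)).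
by rewrite -ler_pdivlMr // ge_min lexx.
Qed.

(** * The norm of a fibre as a dual norm, and completeness *)

Definition xn h f : R := Num.sqrt (nb (hva h h f f)).

Lemma xn_ge0 h f : 0 <= xn h f. Proof. exact: sqrtr_ge0. Qed.
Lemma xn_sqr h f : xn h f ^+ 2 = nb (hva h h f f).
Proof. by rewrite sqr_sqrtr // nb_ge0. Qed.

Lemma xn_approx h f (d : R) : inX h f -> 0 < d -> exists y,
  [/\ inmod h y, kbounded d (fun s => f s - kern y s), mnorm y <= xn h f + d &
      nb (hva h h f f - pairing y f) <= d].
Proof.
move=> hf d0; have [M M0 bM] := inX_bounded hf; have [_ _ af] := hf.
have [gf _ _] := hf.
pose K := M + M + 1; have K0 : 0 < K by rewrite ltr_wpDl // addr_ge0.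
(* [e K <= d^2] gives [mnorm y ^ 2 <= xn^2 + d^2], hence the third claim, and [e K <= d] gives the
   last one. *)
pose e := Num.min (Num.min (d ^+ 2 / K) (d / K)) (Num.min d 1).
have e0 : 0 < e by rewrite !lt_min ltr01 d0 !divr_gt0 // exprn_gt0.
have e1 : e <= 1 by rewrite !ge_min lexx !orbT.
have ed : e <= d by rewrite !ge_min lexx !orbT.
have eK : e * K <= d ^+ 2 by rewrite -ler_pdivlMr // !ge_min lexx.
have eK' : e * K <= d by rewrite -ler_pdivlMr // !ge_min lexx !orbT.
have [y hy yb] := af e e0; exists y; split => //.
- exact: bounded_le ed yb.
- have h1 := hva_ip hf hf hy hy (ltW e0) e1 M0 M0 yb yb bM bM.
  have x0 := xn_ge0 h f.
  rewrite -(ler_pXn2r (n := 2)) ?nnegrE ?mnorm_ge0 ?addr_ge0 ?(ltW d0) //.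
  have h2 : mnorm y ^+ 2 <= xn h f ^+ 2 + e * K.
    rewrite mnorm_sqr xn_sqr.
    have -> : ip y y = hva h h f f - (hva h h f f - ip y y) by abel.
    apply: (le_trans (nbB (deg_hva h h f f) (degB (deg_hva h h f f) (deg_ip hy hy)))).
    by rewrite lerD2l.
  by apply: (le_trans h2); nra.
have [_ hh] := hvaP hf hf.
apply: (le_trans (hh e y M (ltW e0) M0 hy yb bM)); apply: le_trans eK'.
by apply: ler_wpM2l; [exact: ltW | rewrite /K; lra].
Qed.

Lemma bounded_xn h f : inX h f -> kbounded (xn h f) f.
Proof.
move=> hf k z hz; have [gf _ _] := hf; rewrite -subr_le0.
apply: (le0_eps (K := mnorm z + mnorm z)) => d d0 _.
have [y [hy b yl _]] := xn_approx hf d0.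
have : nb (pairing z f) <= nb (pairing z (fun s => f s - kern y s)) + nb (ip z y).
  have gk := graded_kern hy; have gfk := gradedB gf gk.
  have := nbD (deg_pairing hz gfk) (deg_pairing hz gk).
  by rewrite -pairingD (eq_pairing _ (f' := f)) // => s; rewrite subrK.
have := b _ _ hz; have := ip_CS hz hy; have := mnorm_ge0 z.
move: yl; move: (nb _) (nb (pairing z f)) (nb (ip z y)) (mnorm z) (mnorm y) (xn h f) => *; nra.
Qed.

(** For [kern y] close to [f], [xn^2] is nearly the pairing of [y] with [f], hence at most [c xn] up
    to a small error. Together with [bounded_xn] this makes [xn] the least bound, that is the dual
    norm, whence the triangle inequality. *)
Lemma xn_le h f (c : R) : inX h f -> 0 <= c -> kbounded c f -> xn h f <= c.
Proof.
move=> hf c0 bc; have [gf _ _] := hf.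
have : xn h f ^+ 2 - c * xn h f <= 0.
  apply: (le0_eps (K := c + 1)) => d d0 _.
  have [y [hy b yl hy']] := xn_approx hf d0.
  have : xn h f ^+ 2 <= nb (pairing y f) + nb (hva h h f f - pairing y f).
    have dp := deg_pairing hy gf.
    have := nbD dp (degB (deg_hva h h f f) dp); rewrite xn_sqr addrCA subrr addr0 //.
  have := bc _ _ hy; move: hy' yl c0.
  move: (nb _) (nb (pairing y f)) (mnorm y) (xn h f) => *; nra.
have := xn_ge0 h f; rewrite le_eqVlt => /orP[/eqP <- //|x0].
by rewrite subr_le0 expr2 ler_pM2r.
Qed.

Lemma le0_seq (d : nat -> R) (x K : R) : (forall e, 0 < e -> exists n, d n < e) ->
  (forall n, 0 <= d n) -> (forall n, x <= d n * K) -> x <= 0.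
Proof.
move=> d_small d0 h; apply: (le0_eps (K := `|K|)) => e e0 _.
have [n hn] := d_small e e0; apply: (le_trans (h n)).
apply: (@le_trans _ _ (d n * `|K|)); first by apply: ler_wpM2l => //; exact: ler_norm.
by apply: ler_wpM2r; rewrite ?normr_ge0 // ltW.
Qed.

Lemma inX_complete h (F : nat -> tot A -> alg) (d : nat -> R) :
  (forall n, inX h (F n)) ->
  (forall n m, (n <= m)%N -> kbounded (d n) (fun s => F m s - F n s)) ->
  (forall n, 0 <= d n) -> (forall e, 0 < e -> exists n, d n < e) ->
  exists2 f, inX h f & forall n, kbounded (d n) (fun s => f s - F n s).
Proof.
move=> hF cF d0 d_small.
(* Evaluation at [s] is the pairing with [s (x) 1], so a Cauchy sequence in the dual norm converges
   pointwise. *)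
have /choice[f hf] : forall s, exists l : alg, deg (gm (ginv (phi (tg s))) h) l /\
    forall n, nb (l - F n s) <= d n * mnorm [:: (s, 1)].
  move=> s; set g := gm _ h; pose u n : fib B g := coef g (F n s).
  have uE n : emb (tin B (u n)) = F n s by apply: emb_coef; case: (hF n) => gn _ _; exact: gn.
  have [||l hl] := @complete_seq _ u (fun n => d n * mnorm [:: (s, 1)]).
  - by move=> n m nm; rewrite -nb_emb embB !uE; exact: bounded_eval (cF n m nm).
  - move=> e e0; have l0 := mnorm_ge0 [:: (s, 1)]; set L := mnorm _ in l0 *.
    have L1 : 0 < L + 1 by rewrite ltr_wpDl.
    have [n hn] := d_small (e / (L + 1)) ltac:(by rewrite divr_gt0).
    exists n; move: hn; rewrite ltr_pdivlMr // => hn; have := d0 n.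
    by move: (d n) hn => x *; nra.
  exists (emb (tin B l)); split; first exact: deg_tin.
  by move=> n; rewrite -uE -embB nb_emb.
have gf : graded h f by move=> s; case: (hf s).
have fb s n : nb (f s - F n s) <= d n * mnorm [:: (s, 1)] by case: (hf s).
have gfF n : graded h (fun s => f s - F n s) by apply: gradedB => //; case: (hF n).
(* This estimate depends on the list [z] and not only on [mnorm z]; it serves to let [m] tend to
   infinity in [bf]. *)
have pz k z : inmod k z -> forall n, nb (pairing z (fun s => f s - F n s)) <=
    d n * (\sum_(p <- z) nb p.2 * mnorm [:: (p.1, 1)]).
  move=> hz n; elim: z hz => [_|[t b] z IH /= [hp hz]].
    by rewrite pairing_nil nb0 big_nil mulr0.
  rewrite pairing_cons big_cons [d n * _]mulrDr /=.
  have ht : inmod k [:: (t, b)] by [].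
  have dt := deg_pairing ht (gfF n); rewrite pairing_cons pairing_nil addr0 /= in dt.
  apply: (le_trans (nbD dt (deg_pairing hz (gfF n)))); apply: lerD; last exact: IH.
  apply: (le_trans (nbM (deg_star hp) (gfF n t))); rewrite (nb_star hp) mulrCA.
  by apply: ler_wpM2l; [exact: nb_ge0 | exact: fb].
have bf n : kbounded (d n) (fun s => f s - F n s).
  move=> k z hz; rewrite -subr_le0; apply: (le0_seq d_small d0 (K := \sum_(p <- z) nb p.2 * mnorm [:: (p.1, 1)] + mnorm z)) => m.
  have gFm : graded h (F m) by case: (hF m).
  have gFn : graded h (F n) by case: (hF n).
  have e1 : pairing z (fun s => f s - F n s) =
      pairing z (fun s => f s - F m s) + pairing z (fun s => F m s - F n s).
    by rewrite !pairingB; abel.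
  have := nbD (deg_pairing hz (gfF m)) (deg_pairing hz (gradedB gFm gFn)); rewrite -e1.
  have := pz _ _ hz m; rewrite mulrDr.
  have : nb (pairing z (fun s => F m s - F n s)) <= d n * mnorm z + d m * mnorm z.
    have [nm|mn] := leqP n m.
      by apply: (le_trans (cF _ _ nm _ _ hz)); rewrite lerDl mulr_ge0 // mnorm_ge0.
    have := cF _ _ (ltnW mn) _ _ hz; rewrite !pairingB -opprB.
    rewrite (nbN (degB (deg_pairing hz gFm) (deg_pairing hz gFn))) => hh.
    by apply: (le_trans hh); rewrite lerDr mulr_ge0 // mnorm_ge0.
  by move: (nb _) (nb (pairing _ _)) (nb (pairing _ _)) (d n * _) (d m * _) (d m * _) => *; lra.
exists f => //; split => //.
- move=> g c a a'; apply/eqP; rewrite -subr_eq0; apply/eqP.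
  set t := tin A (c *: a + a').
  have dt : deg (gm (ginv (phi g)) h) (f t) := gf t.
  have da : deg (gm (ginv (phi g)) h) (f (tin A a)) := gf (tin A a).
  have da' : deg (gm (ginv (phi g)) h) (f (tin A a')) := gf (tin A a').
  have dx := degB dt (degD (degZ (Num.conj c) da) da').
  apply: (nb_eq0 dx); apply/eqP; rewrite eq_le nb_ge0 andbT.
  pose K := mnorm [:: (t, 1)] + (complex.Re `|Num.conj c| * mnorm [:: (tin A a, 1)] + mnorm [:: (tin A a', 1)]).
  apply: (le0_seq d_small d0 (K := K)) => n; have [_ lF _] := hF n.
  have -> : f t - (Num.conj c *: f (tin A a) + f (tin A a')) =
    (f t - F n t) - (Num.conj c *: (f (tin A a) - F n (tin A a)) + (f (tin A a') - F n (tin A a'))).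
    by rewrite /t lF scalerBr; abel.
  have g1 := gfF n t; have g2 := gfF n (tin A a); have g3 := gfF n (tin A a').
  apply: (le_trans (nbB g1 (degD (degZ _ g2) g3))); rewrite mulrDr; apply: lerD => //.
  apply: (le_trans (nbD (degZ _ g2) g3)); rewrite mulrDr; apply: lerD => //.
  by rewrite (nbZ _ g2) mulrCA; apply: ler_wpM2l => //; exact: Cabs_ge0.
- move=> e e0; have e2 : 0 < e / 2 by rewrite divr_gt0.
  have [n hn] := d_small (e / 2) e2; have [gn _ an] := hF n.
  have [y hy yb] := an (e / 2) e2; exists y => //.
  have := boundedD (gfF n) (gradedB gn (graded_kern hy)) (bf n) yb => bb.
  apply: bounded_le (bounded_ext _ bb) => [|s]; last by abel.
  by rewrite [leRHS](_ : e = e / 2 + e / 2); [rewrite lerD2r ltW | field].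
Qed.

(** * The fibres as Banach spaces *)

Definition xpred h : {pred (tot A -> alg)} := fun f => `[< inX h f >].

Fact xpred_submod h : submod_closed (xpred h).
Proof.
split; first by apply/asboolP; exact: inX0.
by move=> c f f' /asboolP hf /asboolP hf'; apply/asboolP; exact: inX_comb.
Qed.
HB.instance Definition _ h :=
  GRing.isSubmodClosed.Build C (tot A -> alg) (xpred h) (xpred_submod h).

Record xfib h := XFib { xval : tot A -> alg; xvalP : xval \in xpred h }.
HB.instance Definition _ h := [isSub for @xval h].
HB.instance Definition _ h := [Choice of xfib h by <:].
HB.instance Definition _ h := [SubChoice_isSubLmodule of xfib h by <:].

Lemma xfibP h (x : xfib h) : inX h (xval x).
Proof. by case: x => f /= /asboolP. Qed.

Definition xmk h f (hf : inX h f) : xfib h := XFib (asboolT hf : f \in xpred h).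

Lemma xval_inj h (x x' : xfib h) : xval x =1 xval x' -> x = x'.
Proof. by move=> /funext e; exact: val_inj. Qed.

Lemma xvalD h (x x' : xfib h) : xval (x + x') = xval x + xval x'.
Proof. exact: (raddfD \val). Qed.
Lemma xvalZ h (c : C) (x : xfib h) : xval (c *: x) = c *: xval x.
Proof. by []. Qed.
Lemma xvalB h (x x' : xfib h) : xval (x - x') = (fun s => xval x s - xval x' s).
Proof. exact: (raddfB \val). Qed.

Definition xnorm h (x : xfib h) : C := (xn h (xval x))%:C.

Fact xnormD h (x x' : xfib h) : xnorm (x + x') <= xnorm x + xnorm x'.
Proof.
rewrite /xnorm -rmorphD lecR xvalD; apply: xn_le.
- by have := xfibP (x + x'); rewrite xvalD.
- by rewrite addr_ge0 ?xn_ge0.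
by apply: (boundedD (k := h)); try apply: bounded_xn; try exact: xfibP; case: (xfibP x); case: (xfibP x').
Qed.

Fact xnormZ_le h (c : C) (x : xfib h) : xn h (xval (c *: x)) <= complex.Re `|c| * xn h (xval x).
Proof.
apply: xn_le; first exact: xfibP.
  by rewrite mulr_ge0 ?Cabs_ge0 ?xn_ge0.
rewrite xvalZ; apply: (boundedZ (k := h)); first by case: (xfibP x).
by apply: bounded_xn; exact: xfibP.
Qed.

Lemma CabsE (c : C) : `|c| = (complex.Re `|c|)%:C.
Proof.
by have := normr_ge0 c; case: (`|c|) => u v; rewrite lecE /= => /andP[/eqP -> _].
Qed.

Fact xnormZ h (c : C) (x : xfib h) : xnorm (c *: x) = `|c| * xnorm x.
Proof.
apply/eqP; rewrite eq_le; apply/andP; split.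
  by rewrite CabsE /xnorm -rmorphM lecR xnormZ_le.
have [->|c0] := eqVneq c 0.
  by rewrite normr0 mul0r /xnorm lecR xn_ge0.
have := xnormZ_le c^-1 (c *: x); rewrite scalerA mulVf // scale1r => h1.
have : xnorm x <= `|c^-1| * xnorm (c *: x).
  by rewrite [`|c^-1|]CabsE /xnorm -rmorphM lecR.
by rewrite normrV ?unitfE // ler_pdivlMl // normr_gt0.
Qed.

Fact xnorm0 h (x : xfib h) : xnorm x = 0 -> x = 0.
Proof.
move=> /(congr1 (@complex.Re R)) /= x0; apply: xval_inj => s.
have gx : graded h (xval x) by case: (xfibP x).
have b0 : kbounded 0 (xval x) by have := bounded_xn (xfibP x); rewrite x0.
by rewrite (bounded0 gx b0); have -> : xval (0 : xfib h) = 0 by exact: (raddf0 \val).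
Qed.

HB.instance Definition _ h := Lmodule_isNormed.Build C (xfib h) (@xnormD h) (@xnormZ h) (@xnorm0 h).

Lemma nr_xfib h (x : xfib h) : nr x = xn h (xval x).
Proof. by []. Qed.

Lemma bounded_nr h (x : xfib h) : kbounded (nr x) (xval x).
Proof. by rewrite nr_xfib; apply: bounded_xn; exact: xfibP. Qed.

Fact xfib_complete h (F : set_system (xfib h)) : ProperFilter F -> cauchy F -> cvg F.
Proof.
move=> FF Fc.
have bE (x x' : xfib h) (e : R) : ball x (e%:C : C) x' = (nr (x' - x) < e) :> Prop.
  by rewrite -ball_normE /= nrE nr_distC ltcR.
have i0 n : 0 < (n.+1%:R^-1)%:C :> C by rewrite ltcR invr_gt0 ltr0n.
(* Centres of balls of radius [1 / (n + 1)] belonging to the filter form a Cauchy sequence, whose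
   limit is that of the filter. *)
have /choice[u hu] : forall n, exists x : xfib h, F (ball x ((n.+1%:R^-1)%:C : C)).
  by move=> n; exact: (cauchyP _).1 Fc _ (i0 n).
have uu n m : nr (u m - u n) <= n.+1%:R^-1 + m.+1%:R^-1.
  have [x [hx hx']] := filter_ex (filterI (hu n) (hu m)).
  rewrite bE in hx; rewrite bE in hx'.
  have -> : u m - u n = (x - u n) - (x - u m) by abel.
  by apply: (le_trans (nrB _ _)); apply: lerD; exact: ltW.
pose d (n : nat) : R := 2 * n.+1%:R^-1.
have d_small (e : R) : 0 < e -> exists n, d n < e.
  move=> e0; have [n hn] := inv_natS_small (e := e / 2) ltac:(by rewrite divr_gt0).
  by exists n; move: hn; rewrite ltr_pdivlMr // mulrC.
have d0 n : 0 <= d n by rewrite mulr_ge0 // invr_ge0 ler0n.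
have [||f hf bf] := @inX_complete h (fun n => xval (u n)) d _ _ d0 d_small.
- by move=> n; exact: xfibP.
- move=> n m nm; rewrite -xvalB; apply: bounded_le (bounded_nr _).
  apply: (le_trans (uu n m)); rewrite /d mulr_natl mulr2n lerD2l.
  by rewrite lef_pV2 ?posrE ?ltr0n // ler_nat.
pose x := xmk hf.
have xu n : nr (x - u n) <= d n.
  rewrite nr_xfib; apply: xn_le => //; exact: xfibP.
apply/cvg_ex; exists x; apply/cvg_ballP => e e0.
have [e' ee e'0] : exists2 e' : R, e = (e'%:C : C) & 0 < e'.
  move: e0; case: (e) => a b; rewrite ltcE /= => /andP[/eqP -> a0].
  by exists a.
(* A point of the ball is within [1 / (n + 1)] of [u n], and [x] is within [2 / (n + 1)] of it;
   hence the thirds. *)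
have [n hn] := inv_natS_small (e := e' / 3) ltac:(by rewrite divr_gt0).
apply: filterS (hu n) => z; rewrite ee !bE => hz.
have -> : z - x = (z - u n) - (x - u n) by abel.
apply: (le_lt_trans (nrB _ _)); have := xu n; rewrite /d; move: hz hn.
by move: (n.+1%:R^-1) (nr (z - u n)) (nr (x - u n)) => *; lra.
Qed.

HB.instance Definition _ h := Uniform_isComplete.Build (xfib h) (@xfib_complete h).

(** * The operations of the bundle, the action and the cyclic vector *)

Lemma emb_inj (s t : tot B) : tg s = tg t -> emb s = emb t -> s = t.
Proof.
by move=> st e; rewrite -[LHS](tin_coef (h := tg t)) // e tin_coef.
Qed.

Lemma xtot_inj h k (x : xfib h) (x' : xfib k) : h = k -> xval x =1 xval x' ->
  existT (fun l => xfib l : completeNormedModType C) h x = existT _ k x'.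
Proof. by move=> e; case: k / e x' => x' /xval_inj ->. Qed.

(** The reproducing property: [kern y] approximates itself with error 0. *)
Lemma hva_kern h k y f : inmod h y -> inX k f -> hva h k (kern y) f = pairing y f.
Proof.
move=> hy hf; have hk := inX_kern hy; have [M M0 bM] := inX_bounded hf.
have [dh hh] := hvaP hk hf; have [gf _ _] := hf.
apply/eqP; rewrite -subr_eq0; apply/eqP.
apply: (nb_eq0 (degB dh (deg_pairing hy gf))); apply/eqP; rewrite eq_le nb_ge0 andbT.
have := hh 0 y M (lexx _) M0 hy _ bM; rewrite mul0r; apply.
by apply: bounded_zero => // s; rewrite subrr.
Qed.

Definition xact (r s : H) (x : xfib r) (b : fib B s) : xfib (gm r s) :=
  xmk (inX_mulr (xfibP x) (deg_tin b)).
Definition xip (r s : H) (x : xfib r) (y : xfib s) : fib B (gm (ginv r) s) :=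
  hv r s (xval x) (xval y).
Definition xrho (g : G) h (a : fib A g) (x : xfib h) : xfib (gm (phi g) h) :=
  xmk (inX_act (tin A a) (xfibP x)).

Fact xact_linl (r s : H) (k : C) (x x' : xfib r) (b : fib B s) :
  xact (k *: x + x') b = k *: xact x b + xact x' b.
Proof.
apply: xval_inj => t; set c := emb (tin B b).
rewrite -[LHS]/((k *: xval x t + xval x' t) * c) -[RHS]/(k *: (xval x t * c) + xval x' t * c).
by rewrite mulrDl gZAl.
Qed.
Fact xact_linr (r s : H) (k : C) (x : xfib r) (b b' : fib B s) :
  xact x (k *: b + b') = k *: xact x b + xact x b'.
Proof.
apply: xval_inj => t; rewrite -[LHS]/(xval x t * emb (tin B (k *: b + b'))).
rewrite -[RHS]/(k *: (xval x t * emb (tin B b)) + xval x t * emb (tin B b')).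
by rewrite emb_comb mulrDr gZAr.
Qed.
Fact xip_linr (r s : H) (k : C) (x : xfib r) (y y' : xfib s) :
  xip x (k *: y + y') = k *: xip x y + xip x y'.
Proof.
apply: fibI; apply: emb_inj => //; rewrite emb_comb.
by have := hva_comb k (xfibP x) (xfibP y) (xfibP y').
Qed.
Fact xip_act (r s t : H) (x : xfib r) (y : xfib s) (b : fib B t) :
  tin B (xip x (xact y b)) = tin B (fmul B (xip x y) b).
Proof.
apply: emb_inj; first by rewrite /tg /= gmA.
rewrite [RHS](embM (tin B _) (tin B b)).
exact: (hva_mulr (xfibP x) (xfibP y) (deg_tin b)).
Qed.
Fact xip_star (r s : H) (x : xfib r) (y : xfib s) :
  tin B (fstar B (xip x y)) = tin B (xip y x).
Proof.
apply: emb_inj; first by rewrite /tg /= !grpE.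
by rewrite [LHS](emb_star (tin B _)); exact: (hva_star (xfibP x) (xfibP y)).
Qed.
Fact xip_pos r (x : xfib r) : Bpos (tin B (xip x x)).
Proof.
have /pos_positive[+ _] := hva_pos (xfibP x).
by rewrite /hva tin_coef // /tg /= gmVx.
Qed.
Fact xnorm_ip r (x : xfib r) : `|x| ^+ 2 = `|xip x x|.
Proof. by rewrite !nrE -rmorphXn /= nr_xfib xn_sqr /hva nb_emb. Qed.
Fact xip_def r (x : xfib r) : xip x x = 0 -> x = 0.
Proof.
move=> e; apply/eqP; rewrite -normr_eq0 -sqrf_eq0 xnorm_ip e.
by rewrite normr0.
Qed.

Definition xbundle : HilbertBundle B :=
  @Build_HilbertBundle H B (fun h => xfib h : completeNormedModType C) xact xip
    xact_linl xact_linr xip_linr xip_act xip_star xip_pos xip_def xnorm_ip.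

Fact inmod_unit : inmod gone [:: (tot1 A, 1)].
Proof. by split => //; rewrite (homE phiM) gmVx; exact: deg1. Qed.

Definition xxi : xfib gone := xmk (inX_kern inmod_unit).

Lemma xrho_action : @is_action G H A B phi xbundle xrho.
Proof.
split; [|split; [|split; [|split]]].
- move=> g h k a a' x; apply: xval_inj => t.
  rewrite -[RHS]/(k *: xval x (tm (tst (tin A a)) t) + xval x (tm (tst (tin A a')) t)).
  rewrite -[LHS]/(xval x (tm (tst (tin A (k *: a + a'))) t)).
  have -> : tm (tst (tin A (k *: a + a'))) t =
     tin A (Num.conj k *: fmul A (fstar A a) (projT2 t) + fmul A (fstar A a') (projT2 t)).
    by rewrite -fmul_linl -fstar_conjlin.
  by have [_ lx _] := xfibP x; rewrite lx conjCK.
- by move=> g h k a x x'; apply: xval_inj.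
- move=> g g' h a a' x; apply: xtot_inj; first by rewrite phiM !grpE.
  by move=> t /=; rewrite (tstM (tin A a) (tin A a')) tmA.
- move=> g h k a x y; apply: emb_inj; first by rewrite /tg /= !(homE phiM) !grpE.
  have := hva_act (tin A a) (xfibP x) (xfibP y).
  rewrite /hva /=; move=> ->; congr (emb (tin B (hv _ _ _ _))).
  by apply/funext => t /=; rewrite (tstK (tin A a)).
- move=> g h s a x b; apply: xtot_inj; first by rewrite gmA.
  by [].
Qed.

(** By [hva_kern] the inner product with [xxi] is evaluation at the unit, and [rho(a) xi] takes
    there the value of [xi] at [a^*], which is [T(a)]. *)
Lemma xxi_represents g (a : fib A g) : tin B (T a) = tin B (xip xxi (xrho a xxi)).
Proof.
apply: emb_inj; first by rewrite /tg /= ginv1 gm1x gmx1.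
rewrite [RHS](hva_kern inmod_unit (xfibP (xrho a xxi))).
by rewrite pairing_one /= kern_cons /kern big_nil addr0 mulr1 !tms1 tstK.
Qed.
End Kernel.

Theorem theorem6p1 (G H : DGroup) (A : UFellBundle G) (B : UFellBundle H)
    (phi : G -> H) (T : forall g : G, fib A g -> fib B (phi g)) :
  is_hom phi -> is_bundle_map T -> pos_def T ->
  exists (X : HilbertBundle B)
         (rho : forall g h, fib A g -> hfib X h -> hfib X (gm (phi g) h))
         (xi : hfib X gone),
    is_action rho /\
    forall (g : G) (a : fib A g),
      existT (fib B) _ (T g a) = existT (fib B) _ (hip X xi (rho _ _ a xi)).
Proof.
move=> phiM Tb Tp; exists (xbundle phiM Tb Tp), (@xrho _ _ _ _ _ _ phiM Tb Tp).
by exists (xxi phiM Tb); split; [exact: xrho_action | exact: xxi_represents].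
Qed.
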